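(* Let $(\mu,\nu)\in\mathcal{P}(\mathcal{X})\times\mathcal{P}(\mathcal{Y})$ and let $c:\mathcal{X}\times\mathcal{Y}\to[0,\infty)$ be continuous. Suppose that $e^{\beta c}\in L^1(\mu\otimes\nu)$ for some $\beta>0$. Then $\mathcal{C}(\mu,\nu)<\infty$ and the Sinkhorn iterates $(\pi_n)$ converge in total variation to the optimal coupling $\pi_*$ of $\mathcal{C}(\mu,\nu)$.
   Context: $\mathcal{X},\mathcal{Y}$ are Polish spaces with their Borel $\sigma$-fields and $\mathcal{P}(\mathcal{X}),\mathcal{P}(\mathcal{Y})$ are the sets of Borel probability measures. $\Pi(\mu,\nu)$ is the set of couplings, i.e. probability measures on $\mathcal{X}\times\mathcal{Y}$ with marginals $(\mu,\nu)$. The entropic optimal transport problem is $$\mathcal{C}(\mu,\nu):=\inf_{\pi\in\Pi(\mu,\nu)}\int c\,d\pi+H(\pi|\mu\otimes\nu),$$ where $H(\pi|\rho)=\int\log\frac{d\pi}{d\rho}\,d\pi$ if $\pi\ll\rho$ and $H(\pi|\rho)=\infty$ otherwise. If $\mathcal{C}(\mu,\nu)<\infty$, there is a unique minimizer $\pi_*\in\Pi(\mu,\nu)$, called the optimal coupling. Sinkhorn's algorithm: set $\varphi_0:=0$ and, for integers $t\ge0$, $$\psi_t(y):=-\log\int_{\mathcal{X}}e^{\varphi_t(x)-c(x,y)}\,\mu(dx),\qquad \varphi_{t+1}(x):=-\log\int_{\mathcal{Y}}e^{\psi_t(y)-c(x,y)}\,\nu(dy)$$ (these functions are well defined $\nu$-a.s.,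 respectively $\mu$-a.s.). With $d\pi(\varphi,\psi):=e^{\varphi\oplus\psi-c}\,d(\mu\otimes\nu)$, where $(\varphi\oplus\psi)(x,y)=\varphi(x)+\psi(y)$, the Sinkhorn iterates are the probability measures on $\mathcal{X}\times\mathcal{Y}$ $$\pi_{2t}:=\pi(\varphi_t,\psi_t),\qquad \pi_{2t+1}:=\pi(\varphi_{t+1},\psi_t),\qquad t\ge0.$$ *)

(* Defs.v *)
From HB Require Import structures.
From mathcomp Require Import all_boot all_order all_algebra.
From mathcomp Require Import all_classical all_reals all_analysis.

Set Implicit Arguments.
Unset Strict Implicit.
Unset Printing Implicit Defensive.

Import Order.TTheory GRing.Theory Num.Theory.
Import numFieldNormedType.Exports.

Local Open Scope classical_set_scope.
Local Open Scope ring_scope.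

Definition complete_metric_for (R : realType) (T : topologicalType)
    (d : T -> T -> R) : Prop :=
  [/\ [/\ forall x, d x x = 0,
          forall x y, d x y = 0 -> x = y,
          forall x y, d x y = d y x
        & forall x y z, d x z <= d x y + d y z],
      forall (x : T) (A : set T),
        nbhs x A <-> exists2 e : R, 0 < e & [set y | d x y < e] `<=` A
    & forall u : nat -> T,
        (forall e : R, 0 < e -> exists N : nat, forall m n : nat,
           (N <= m)%N -> (N <= n)%N -> d (u m) (u n) < e) ->
        exists l : T, u @ \oo --> l].

Definition polish (R : realType) (T : topologicalType) : Prop :=
  (exists d : T -> T -> R, complete_metric_for d) /\
  (exists2 D : set T, countable D & dense D).

(* For Polish X and Y the library's product sigma-algebra on borel X * borel Y
   is the Borel sigma-algebra of X * Y, both spaces being second countable. *)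
Notation borel X := (g_sigma_algebraType (@open X)).

Local Open Scope ereal_scope.

(* The negative part of log(drho/dm) is rho-integrable when rho << m, so the
   extended integral below is never of the form oo - oo. *)
Definition relative_entropy (R : realType) (d : measure_display)
    (T : measurableType d) (rho m : probability T R) : \bar R :=
  if pselect (rho `<< m) is left _
  then \int[rho]_z lne (Radon_Nikodym (charge_of_finite_measure rho) m z)
  else +oo.

Definition total_variation_dist (R : realType) (d : measure_display)
    (T : measurableType d) (m1 m2 : set T -> \bar R) : \bar R :=
  ereal_sup [set `|m1 A - m2 A| | A in measurable].

Section entropic_optimal_transport.
Context (R : realType) (d1 d2 : measure_display).
Context (X : measurableType d1) (Y : measurableType d2).
Variables (mu : probability X R) (nu : probability Y R) (c : X * Y -> R).

Definition coupling (p : probability (X * Y)%type R) : Prop :=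
  (forall A, measurable A -> pushforward p fst A = mu A) /\
  (forall B, measurable B -> pushforward p snd B = nu B).

Definition eot_cost (p : probability (X * Y)%type R) : \bar R :=
  \int[p]_z (c z)%:E + relative_entropy p (mu \x nu).

Definition eot_value : \bar R := ereal_inf [set eot_cost p | p in coupling].

Definition eot_minimizer (p : probability (X * Y)%type R) : Prop :=
  coupling p /\ eot_cost p = eot_value.

(* Probability measures are only compared on measurable sets: the library's
   measures also carry unconstrained values on non-measurable ones. *)
Definition optimal_coupling (p : probability (X * Y)%type R) : Prop :=
  eot_minimizer p /\
  forall q, eot_minimizer q -> forall A, measurable A -> q A = p A.

(* The potentials take values in the extended reals: on the null set where an
   integral is infinite, -log gives -oo and the potential is still defined. *)
Definition sinkhorn_Y (phi : X -> \bar R) (y : Y) : \bar R :=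
  - lne (\int[mu]_x expeR (phi x - (c (x, y))%:E)).

Definition sinkhorn_X (psi : Y -> \bar R) (x : X) : \bar R :=
  - lne (\int[nu]_y expeR (psi y - (c (x, y))%:E)).

Fixpoint sinkhorn_phi (t : nat) : X -> \bar R :=
  if t is s.+1 then sinkhorn_X (sinkhorn_Y (sinkhorn_phi s)) else cst 0.

Definition sinkhorn_psi (t : nat) : Y -> \bar R :=
  sinkhorn_Y (sinkhorn_phi t).

Definition potential_measure (phi : X -> \bar R) (psi : Y -> \bar R)
    (A : set (X * Y)) : \bar R :=
  \int[mu \x nu]_(z in A) expeR (phi z.1 + psi z.2 - (c z)%:E).

Definition sinkhorn_iterate (n : nat) : set (X * Y) -> \bar R :=
  let t := n./2 in
  if odd n then potential_measure (sinkhorn_phi t.+1) (sinkhorn_psi t)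
  else potential_measure (sinkhorn_phi t) (sinkhorn_psi t).

End entropic_optimal_transport.

(* Main.v *)
Require Import Defs.
From HB Require Import structures.
From mathcomp Require Import all_boot all_order all_algebra.
From mathcomp Require Import all_classical all_reals all_analysis.
From mathcomp Require Import measurable_realfun.
From mathcomp Require Import ring lra.

Set Implicit Arguments.
Unset Strict Implicit.
Unset Printing Implicit Defensive.

Import Order.TTheory GRing.Theory Num.Theory.
Import numFieldNormedType.Exports.

Local Open Scope classical_set_scope.
Local Open Scope ring_scope.

(** Why the iterates converge to the optimal coupling.

Put m = mu x nu. The iterate pi_{2t} has density p_t = exp (F_t + G_t - c)
with respect to m, where F_t and G_t are real versions of the potentials.
Its Y-marginal is nu and its X-marginal is h_t mu with
h_t = exp (F_t - F_{t+1}). The exponential moment makes c integrable, and the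
proof has four ingredients.

A priori bounds. A half step replaces one potential by a soft minimum of c
minus the other one. Jensen's inequality turns this into F_t <= C1 and
G_t <= C2, where C1 and C2 are the partial integrals of c, while the integrals
of F_t and G_t start nonnegative and never decrease [soft_transformP]. So both
potentials are bounded in L1, and the sequence int F_t converges. Its
increments are the relative entropies of mu with respect to h_t mu; these
dominate the L1 distance from h_t to 1, hence h_t --> 1 [fst_marginal_cvg].

Cauchy property. For two iterates k and n put f = F_k - F_n and
g = G_k - G_n, so that ln p_k - ln p_n = f + g, and let clip be the truncation
to [-M, M]. Since clip is odd and monotone,
(p_k - p_n) (clip f + clip g) is nonnegative; since each clipped term depends
on one variable only, its integral involves only the marginals, and it vanishes
in the limit. Where nothing is truncated this product controls
(p_k - p_n)^2; the rest is negligible because the potentials are bounded in L1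
and because p_t <= exp (C1 + C2) with almost constant marginals makes the
densities uniformly integrable [gibbs_dist_le, gibbs_cauchy].

Shape of the limit. Along an almost everywhere convergent subsequence only the
sums F_t + G_t are known to converge. Freezing one point y0 separates them into
two convergent sequences, and Fatou's lemma makes both limits F and G finite
and integrable [gibbs_limit]. The limit is thus a coupling with density
exp (F + G - c).

Optimality. Every coupling integrates F + G to the same number. By Gibbs'
inequality, applied to F + G - c, this number is a lower bound of the cost,
attained only at the coupling with density exp (F + G - c)
[dual_le_cost, gibbs_cost_le_dual].

The iterate pi_{2t+1} is at L1 distance int |h_t - 1| dmu from pi_{2t}, so it has
the same limit [iterate_density_dist]. *)

(** * Integrable functions and almost-everywhere comparison *)

Notation L1 P f := (P.-integrable [set: _] (fun x => (f x)%:E)).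

Section almost_everywhere_integration.
Context d (T : measurableType d) (R : realType).
Variable P : {measure set T -> \bar R}.
Implicit Types f g : T -> R.

(** The two sides may be infinite: the integral of an extended real function is
    the difference of two nonnegative integrals, each of them monotone. *)
Lemma ae_le_integral (f g : T -> \bar R) :
  measurable_fun setT f -> measurable_fun setT g ->
  {ae P, forall x, (f x <= g x)%E} ->
  (\int[P]_x f x <= \int[P]_x g x)%E.
Proof.
move=> mf mg fg; rewrite integralE [leRHS]integralE; apply: leeB.
- apply: ae_ge0_le_integral => //.
  + exact: measurable_funepos.
  + exact: measurable_funepos.
  + by apply: filterS fg => x fgx _; rewrite !funeposE ge_max !le_max fgx lexx !orbT.
- apply: ae_ge0_le_integral => //.
  + exact: measurable_funeneg.
  + exact: measurable_funeneg.
  + by apply: filterS fg => x fgx _; rewrite !funenegE ge_max !le_max leeN2 fgx lexx !orbT.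
Qed.

Lemma L1_measurable f : L1 P f -> measurable_fun setT f.
Proof. by move=> /measurable_int /measurable_EFinP. Qed.

Lemma L1D f g : L1 P f -> L1 P g -> L1 P (fun x => f x + g x).
Proof. by move=> /integrableD-/(_ measurableT) h /h. Qed.

Lemma L1Z k f : L1 P f -> L1 P (fun x => k * f x).
Proof. by move=> /(integrableZl measurableT k). Qed.

Lemma L1N f : L1 P f -> L1 P (fun x => - f x).
Proof. by move=> /integrableN. Qed.

Lemma L1B f g : L1 P f -> L1 P g -> L1 P (fun x => f x - g x).
Proof. by move=> Lf /L1N; apply: L1D. Qed.

Lemma L1_norm f : L1 P f -> L1 P (fun x => `|f x|).
Proof. exact: integrable_norm. Qed.

Lemma EFin_Rintegral f : L1 P f -> (\int[P]_x f x)%:E = (\int[P]_x (f x)%:E)%E.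
Proof. by move=> Lf; rewrite fineK//; exact: integrable_fin_num. Qed.

Lemma L1_le_ae f g : measurable_fun setT f -> L1 P g ->
  {ae P, forall x, `|f x| <= g x} -> L1 P f.
Proof.
move=> mf /[dup] Lg /integrableP[mg gy] fg; apply/integrableP; split.
  exact/measurable_EFinP.
apply: le_lt_trans gy; apply: ae_le_integral.
- by do 2 apply: measurableT_comp => //; exact/measurable_EFinP.
- exact: measurableT_comp.
- by apply: filterS fg => x fgx; rewrite lee_fin; apply: le_trans fgx (ler_norm _).
Qed.

Lemma ge0_L1 f : measurable_fun setT f -> (forall x, 0 <= f x) ->
  (\int[P]_x (f x)%:E < +oo)%E -> L1 P f.
Proof.
move=> mf f0 fy; apply/integrableP; split; first exact/measurable_EFinP.
by under eq_integral do rewrite gee0_abs ?lee_fin//.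
Qed.

Lemma ae_le_Rintegral f g : L1 P f -> L1 P g -> {ae P, forall x, f x <= g x} ->
  \int[P]_x f x <= \int[P]_x g x.
Proof.
move=> Lf Lg fg; rewrite -lee_fin !EFin_Rintegral//; apply: ae_le_integral.
- exact: measurable_int Lf.
- exact: measurable_int Lg.
- by apply: filterS fg.
Qed.

Lemma ae_eq_Rintegral f g : measurable_fun setT f -> measurable_fun setT g ->
  {ae P, forall x, f x = g x} -> \int[P]_x f x = \int[P]_x g x.
Proof.
move=> mf mg fg; congr fine; apply: ae_eq_integral => //; try exact/measurable_EFinP.
by apply: filterS fg => x + _ => ->.
Qed.

Lemma L1_fine (f : T -> \bar R) :
  P.-integrable setT f -> L1 P (fun x => fine (f x)).
Proof.
move=> Lf; apply: (le_integrable _ _ _ Lf) => //.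
  apply/measurable_EFinP; apply: measurableT_comp => //.
  exact: measurable_int Lf.
by move=> x _; case: (f x) => [r| |] /=; rewrite ?normr0 ?lexx ?leey.
Qed.

Lemma L1_boundedM (phi f : T -> R) (M : R) : measurable_fun setT phi ->
  (forall x, `|phi x| <= M) -> L1 P f -> L1 P (fun x => phi x * f x).
Proof.
move=> mphi phiM Lf; apply: (@L1_le_ae _ (fun x => M * `|f x|)).
- by apply: measurable_funM => //; exact: L1_measurable Lf.
- by apply: L1Z; exact: L1_norm.
- by apply: aeW => x; rewrite normrM ler_wpM2r.
Qed.

(** An upper bound for [f] and the sign of its integral bound both parts of [f],
    because |f| <= 2 C - f whenever f <= C and 0 <= C. *)
Lemma L1_norm_le (f C : T -> R) :
  L1 P f -> L1 P C -> (forall x, 0 <= C x) -> {ae P, forall x, f x <= C x} ->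
  0 <= \int[P]_x f x -> \int[P]_x `|f x| <= 2 * \int[P]_x C x.
Proof.
move=> Lf LC C0 fC f0; apply: (@le_trans _ _ (\int[P]_x (2 * C x - f x))).
  apply: ae_le_Rintegral.
  - exact: L1_norm.
  - by apply: L1B => //; exact: L1Z.
  - apply: filterS fC => x fC; have := C0 x; have [f_ge0|f_lt0] := leP 0 (f x).
      by rewrite ger0_norm//; lra.
    by rewrite ltr0_norm//; lra.
by rewrite RintegralB//; [rewrite RintegralZl//; lra|exact: L1Z].
Qed.

End almost_everywhere_integration.

Section probability_integration.
Context d (T : measurableType d) (R : realType) (P : probability T R).

Lemma L1_cst (k : R) : L1 P (fun=> k).
Proof. exact: finite_measure_integrable_cst. Qed.

Lemma Rintegral_prob_cst (k : R) : \int[P]_x k = k.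
Proof. by rewrite Rintegral_cst// -[X in _ * X]/(fine (P setT)) probability_setT mulr1. Qed.

Lemma integral_prob1 : (\int[P]_x cst 1 x = 1)%E.
Proof. by rewrite integral_cst// mul1e; exact: probability_setT. Qed.

Lemma L1_bounded (f : T -> R) (M : R) : measurable_fun setT f ->
  (forall x, `|f x| <= M) -> L1 P f.
Proof.
by move=> mf fM; apply: (L1_le_ae mf (L1_cst M)); apply: aeW => x.
Qed.

Lemma ae_exists (Q : T -> Prop) : {ae P, forall x, Q x} -> exists x, Q x.
Proof.
move=> [N [mN N0 sub]]; apply: contrapT => nQ.
have NT : N = setT.
  by rewrite -subTset => x _; apply: sub => /= Qx; apply: nQ; exists x.
by move: N0; rewrite NT probability_setT => /eqP; rewrite onee_eq0.
Qed.

End probability_integration.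

(** * Product measures: sections and marginals *)

Section product_of_probabilities.
Context (R : realType) (d1 d2 : measure_display).
Context (X : measurableType d1) (Y : measurableType d2).
Variables (mu : probability X R) (nu : probability Y R).
Local Notation m := (mu \x nu)%E.

Lemma ae_fst (Q : X -> Prop) :
  {ae mu, forall x, Q x} -> {ae m, forall z, Q z.1}.
Proof.
move=> [N [mN N0 sub]]; exists (N `*` setT); split.
- exact: measurableX.
- by rewrite product_measure1E// -[X in (X * _)%E]/(mu N) N0 mul0e.
- by move=> [x y] /= nQ; split => //; apply: sub.
Qed.

Lemma ae_snd (Q : Y -> Prop) :
  {ae nu, forall y, Q y} -> {ae m, forall z, Q z.2}.
Proof.
move=> [N [mN N0 sub]]; exists (setT `*` N); split.
- exact: measurableX.
- by rewrite product_measure1E// -[X in (_ * X)%E]/(nu N) N0 mule0.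
- by move=> [x y] /= nQ; split => //; apply: sub.
Qed.

Lemma ae_section_snd (Q : X * Y -> Prop) : {ae m, forall z, Q z} ->
  {ae mu, forall x, {ae nu, forall y, Q (x, y)}}.
Proof.
move=> [N [mN N0 sub]].
have h : (\int[mu]_x `|(nu \o xsection N) x| = 0)%E.
  by under eq_integral do rewrite gee0_abs//.
have /(ae_eq_integral_abs mu measurableT) hN := measurable_fun_xsection nu mN.
move/hN : h; apply: filterS => x /(_ I) /= Nx.
exists (xsection N x); split => //; first exact: measurable_xsection.
by move=> y nQ; rewrite /xsection /= inE; exact: sub.
Qed.

Lemma ae_section_fst (Q : X * Y -> Prop) : {ae m, forall z, Q z} ->
  {ae nu, forall y, {ae mu, forall x, Q (x, y)}}.
Proof.
move=> [N [mN N0 sub]].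
have h : (\int[nu]_y `|(mu \o ysection N) y| = 0)%E.
  under eq_integral do rewrite gee0_abs//.
  rewrite -(indic_fubini_tonelli_GE mu mN) -fubini_tonelli2//.
  - by rewrite integral_indic// setIT.
  - exact/measurable_EFinP/measurable_indic.
  - by move=> z; rewrite lee_fin.
have /(ae_eq_integral_abs nu measurableT) hN := measurable_fun_ysection mu mN.
move/hN : h; apply: filterS => y /(_ I) /= Ny.
exists (ysection N y); split => //; first exact: measurable_ysection.
by move=> x nQ; rewrite /ysection /= inE; exact: sub.
Qed.

Lemma measurable_section_snd (p : X * Y -> R) x :
  measurable_fun setT p -> measurable_fun setT (fun y => p (x, y)).
Proof. by move=> mp; exact: (measurableT_comp mp (measurable_pair1 x)). Qed.

Lemma measurable_section_fst (p : X * Y -> R) y :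
  measurable_fun setT p -> measurable_fun setT (fun x => p (x, y)).
Proof. by move=> mp; exact: (measurableT_comp mp (measurable_pair2 y)). Qed.

(** Fubini's theorem for a function of [x] alone against a density [p] whose
    [x]-marginal has density [h]. *)
Lemma integral_fst_marginal (p : X * Y -> R) (h phi : X -> R) :
  measurable_fun setT p -> (forall z, 0 <= p z) ->
  measurable_fun setT phi -> L1 mu (fun x => phi x * h x) ->
  {ae mu, forall x, (\int[nu]_y (p (x, y))%:E = (h x)%:E)%E} ->
  L1 m (fun z => phi z.1 * p z) /\
  \int[m]_z (phi z.1 * p z) = \int[mu]_x (phi x * h x).
Proof.
move=> mp p0 mphi Lh ph.
have mpp : measurable_fun setT (fun z => phi z.1 * p z).
  by apply: measurable_funM => //; exact: measurableT_comp.
have secE x k : (\int[nu]_y (p (x, y))%:E = (h x)%:E)%E ->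
    (\int[nu]_y (k * p (x, y))%:E = (k * h x)%:E)%E.
  move=> phx; rewrite EFinM -phx -integralZl//.
  apply: ge0_L1 => //; first exact: measurable_section_snd.
  by rewrite phx ltry.
have Lpp : L1 m (fun z => phi z.1 * p z).
  apply/integrableP; split; first exact/measurable_EFinP.
  move/integrableP: Lh => [mh]; apply: le_lt_trans.
  rewrite fubini_tonelli1//; last first.
    by apply: measurableT_comp => //; exact/measurable_EFinP.
  apply: ae_le_integral.
  - apply: measurable_fun_fubini_tonelli_F => //.
    by apply: measurableT_comp => //; exact/measurable_EFinP.
  - exact: measurableT_comp.
  - apply: filterS ph => x /(secE x `|phi x|) phx.
    rewrite /fubini_F /= normrM EFinM.
    under eq_integral do rewrite /= normrM (ger0_norm (p0 _)).
    by rewrite phx -EFinM lee_fin ler_wpM2l// ler_norm.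
split => //.
congr fine; rewrite -(integral12_prod_meas1 Lpp).
apply: ae_eq_integral => //.
- exact: (measurable_fubini_F Lpp).
- exact: measurable_int Lh.
- by apply: filterS ph => x /(secE x (phi x)) + _; rewrite /fubini_F.
Qed.

Lemma integral_snd_marginal (p : X * Y -> R) (h phi : Y -> R) :
  measurable_fun setT p -> (forall z, 0 <= p z) ->
  measurable_fun setT phi -> L1 nu (fun y => phi y * h y) ->
  {ae nu, forall y, (\int[mu]_x (p (x, y))%:E = (h y)%:E)%E} ->
  L1 m (fun z => phi z.2 * p z) /\
  \int[m]_z (phi z.2 * p z) = \int[nu]_y (phi y * h y).
Proof.
move=> mp p0 mphi Lh ph.
have mpp : measurable_fun setT (fun z => phi z.2 * p z).
  by apply: measurable_funM => //; exact: measurableT_comp.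
have secE y k : (\int[mu]_x (p (x, y))%:E = (h y)%:E)%E ->
    (\int[mu]_x (k * p (x, y))%:E = (k * h y)%:E)%E.
  move=> phx; rewrite EFinM -phx -integralZl//.
  apply: ge0_L1 => //; first exact: measurable_section_fst.
  by rewrite phx ltry.
have Lpp : L1 m (fun z => phi z.2 * p z).
  apply/integrableP; split; first exact/measurable_EFinP.
  move/integrableP: Lh => [mh]; apply: le_lt_trans.
  rewrite fubini_tonelli2//; last first.
    by apply: measurableT_comp => //; exact/measurable_EFinP.
  apply: ae_le_integral.
  - apply: measurable_fun_fubini_tonelli_G => //.
    by apply: measurableT_comp => //; exact/measurable_EFinP.
  - exact: measurableT_comp.
  - apply: filterS ph => y /(secE y `|phi y|) phx.
    rewrite /fubini_G /= normrM EFinM.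
    under eq_integral do rewrite /= normrM (ger0_norm (p0 _)).
    by rewrite phx -EFinM lee_fin ler_wpM2l// ler_norm.
split => //.
congr fine; rewrite -(integral21_prod_meas1 Lpp).
apply: ae_eq_integral => //.
- exact: (measurable_fubini_G Lpp).
- exact: measurable_int Lh.
- by apply: filterS ph => y /(secE y (phi y)) + _; rewrite /fubini_G.
Qed.

Lemma L1_fst (f : X -> R) : L1 mu f ->
  L1 m (fun z => f z.1) /\ \int[m]_z f z.1 = \int[mu]_x f x.
Proof.
move=> Lf; have := @integral_fst_marginal (cst 1) (cst 1) f.
move=> []//; first exact: L1_measurable Lf.
- by under eq_fun do rewrite /cst mulr1.
- by apply: aeW => x; exact: integral_prob1.
- under eq_fun do rewrite /cst mulr1.
  under eq_Rintegral do rewrite /cst mulr1.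
  by under [in X in _ = X -> _]eq_Rintegral do rewrite /cst mulr1.
Qed.

Lemma L1_snd (g : Y -> R) : L1 nu g ->
  L1 m (fun z => g z.2) /\ \int[m]_z g z.2 = \int[nu]_y g y.
Proof.
move=> Lg; have := @integral_snd_marginal (cst 1) (cst 1) g.
move=> []//; first exact: L1_measurable Lg.
- by under eq_fun do rewrite /cst mulr1.
- by apply: aeW => x; exact: integral_prob1.
- under eq_fun do rewrite /cst mulr1.
  under eq_Rintegral do rewrite /cst mulr1.
  by under [in X in _ = X -> _]eq_Rintegral do rewrite /cst mulr1.
Qed.

End product_of_probabilities.

(** * Almost-everywhere limits of functions bounded in L1 *)

Section subsequences.

Lemma frequently_subseq (Q : nat -> Prop) :
  (forall N, exists2 n, (N <= n)%N & Q n) ->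
  exists s : nat -> nat, (forall j, (j <= s j)%N) /\ forall j, Q (s j).
Proof.
move=> frQ.
have /choice[next nextP] : forall N, exists n, (N <= n)%N /\ Q n.
  by move=> N; have [n ? ?] := frQ N; exists n.
by exists next; split => j; have [] := nextP j.
Qed.

End subsequences.

Section almost_everywhere_limits.
Context d (T : measurableType d) (R : realType).
Variable P : {measure set T -> \bar R}.

Lemma fatou_bound (f : nat -> T -> R) (K : R) (N : nat) :
  (forall n, measurable_fun setT (f n)) -> (forall n x, 0 <= f n x) ->
  (forall n, (N <= n)%N -> (\int[P]_x (f n x)%:E <= K%:E)%E) ->
  (\int[P]_x limn_einf (fun n => (f n x)%:E) <= K%:E)%E.
Proof.
move=> mf f0 fK; apply: (@le_trans _ _ (limn_einf (fun n => \int[P]_x (f n x)%:E)%E)).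
  apply: (@fatou _ _ _ P _ measurableT (fun n x => (f n x)%:E)) => //.
    by move=> n; exact/measurable_EFinP.
  by move=> n x _; rewrite lee_fin.
rewrite limn_einf_lim; apply: lime_le; first exact: is_cvg_einfs.
apply: nearW => n; apply: (@le_trans _ _ (\int[P]_x (f (maxn n N) x)%:E)%E).
  by apply: ereal_inf_lbound; exists (maxn n N) => //=; exact: leq_maxl.
by apply: fK; exact: leq_maxr.
Qed.

Lemma frequently_le_limn_einf (u : nat -> R) : (limn_einf (fun n => (u n)%:E) < +oo)%E ->
  exists B, forall N, exists2 n, (N <= n)%N & u n <= B.
Proof.
move=> uy; apply: contrapT => nB; move: uy; apply/negP; rewrite -leNgt leye_eq.
apply/eqP/eqyP => A A0; rewrite limn_einf_lim.
have [N uN] : exists N, forall n, (N <= n)%N -> A < u n.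
  apply: contrapT => nN; apply: nB; exists A => N.
  apply: contrapT => nn; apply: nN; exists N => n Nn.
  by rewrite ltNge; apply/negP => unA; apply: nn; exists n.
apply: (@le_trans _ _ (einfs (fun n => (u n)%:E) N)); last first.
  rewrite (cvg_lim _ (@cvg_einfs_sup R (fun n => (u n)%:E)))//.
  by apply: ereal_sup_ubound; exists N.
by apply: le_ereal_inf_tmp => _ [n /= Nn <-]; rewrite lee_fin ltW// uN.
Qed.

(** By Fatou's lemma the lower limit of |f_n| is integrable, hence finite almost
    everywhere. *)
Lemma fatou_frequently_bounded (f : nat -> T -> R) (K : R) :
  (forall n, L1 P (f n)) -> (forall n, \int[P]_x `|f n x| <= K) ->
  {ae P, forall x, exists B, forall N, exists2 n, (N <= n)%N & `|f n x| <= B}.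
Proof.
move=> Lf fK; have mf n := L1_measurable (L1_norm (Lf n)).
have fat : (\int[P]_x limn_einf (fun n => `|f n x|%:E) <= K%:E)%E.
  apply: (@fatou_bound (fun n x => `|f n x|) K 0%N) => // n _.
  by rewrite -EFin_Rintegral ?lee_fin//; exact: L1_norm.
have lim0 x : (0 <= limn_einf (fun n => `|f n x|%:E))%E.
  rewrite limn_einf_lim; apply: lime_ge; first exact: is_cvg_einfs.
  by apply: nearW => n; apply: le_ereal_inf_tmp => _ [k _ <-]; rewrite lee_fin.
have : P.-integrable setT (fun x => limn_einf (fun n => `|f n x|%:E)).
  apply/integrableP; split.
    apply: measurableT_comp => //; apply: measurable_fun_limn_esup => n.
    by apply: measurableT_comp => //; exact/measurable_EFinP.
  under eq_integral do rewrite gee0_abs//.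
  exact: le_lt_trans fat (ltry _).
move=> /integrable_ae-/(_ measurableT); apply: filterS => x /(_ I).
by rewrite ge0_fin_numE// => /frequently_le_limn_einf.
Qed.

(** A bounded subsequence keeps the limit of [expR (u n)] away from 0, where
    the logarithm is continuous. *)
Lemma cvg_ln_frequently (u : nat -> R) : cvgn (fun n => expR (u n)) ->
  (exists B, forall N, exists2 n, (N <= n)%N & `|u n| <= B) -> cvgn u.
Proof.
move=> /cvg_ex[l ul] [B uB].
have l0 : 0 < l.
  rewrite ltNge; apply/negP => l0.
  have /cvgrPdist_lt/(_ (expR (- B)) (expR_gt0 _)) [N _ uN] := ul.
  have [n Nn unB] := uB N; have := uN n Nn.
  apply/negP; rewrite -leNgt distrC ler_normr; apply/orP; left.
  have : expR (- B) <= expR (u n) by rewrite ler_expR; move: unB; rewrite ler_norml => /andP[].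
  lra.
apply/cvg_ex; exists (ln l).
rewrite (_ : u = @ln R \o (fun n => expR (u n))); last by apply/funext => n /=; rewrite expRK.
by apply: continuous_cvg => //; exact: continuous_ln.
Qed.

(** The hypothesis on exponentials allows [-oo] as a limit of [f n x]; the L1
    bound rules it out almost everywhere. *)
Lemma L1_limit (f : nat -> T -> R) (K : R) :
  (forall n, L1 P (f n)) -> (forall n, \int[P]_x `|f n x| <= K) ->
  {ae P, forall x, cvgn (fun n => expR (f n x))} ->
  exists2 g : T -> R, L1 P g & {ae P, forall x, (fun n => f n x) @ \oo --> g x}.
Proof.
move=> Lf fK ef; have mf n := L1_measurable (Lf n).
pose g x := fine (limn_esup (fun n => (f n x)%:E)).
have mg : measurable_fun setT g.
  apply: measurableT_comp => //; apply: measurable_fun_limn_esup => n.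
  exact/measurable_EFinP.
have fg : {ae P, forall x, (fun n => f n x) @ \oo --> g x}.
  apply: filterS2 ef (fatou_frequently_bounded Lf fK) => x efx /(cvg_ln_frequently efx).
  move=> /cvg_ex[l fl]; rewrite /g.
  have /cvg_limn_einf_sup[_ ->] : (fun n => (f n x)%:E) @ \oo --> l%:E.
    by apply: cvg_EFin => //; exact: nearW.
  exact: fl.
exists g => //; apply/integrableP; split; first exact/measurable_EFinP.
have fat : (\int[P]_x limn_einf (fun n => `|f n x|%:E) <= K%:E)%E.
  apply: (@fatou_bound (fun n x => `|f n x|) K 0%N) => //.
    by move=> n; exact: L1_measurable (L1_norm (Lf n)).
  by move=> n _; rewrite -EFin_Rintegral ?lee_fin//; exact: L1_norm.
apply: le_lt_trans (ltry K); apply: le_trans fat; apply: ae_le_integral.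
- by apply: measurableT_comp => //; exact/measurable_EFinP.
- apply: measurableT_comp => //; apply: measurable_fun_limn_esup => n.
  apply: measurableT_comp => //; apply/measurable_EFinP.
  exact: L1_measurable (L1_norm (Lf n)).
apply: filterS fg => x /cvg_norm fgx.
have /cvg_limn_einf_sup[-> _] : (fun n => `|f n x|%:E) @ \oo --> `|g x|%:E.
  by apply: cvg_EFin => //; exact: nearW.
by [].
Qed.

(** Along a subsequence with summable successive distances, the sum of these
    distances is integrable, so the telescoping series converges absolutely
    almost everywhere. *)
Lemma L1_cauchy_subseq (g : nat -> T -> R) : (forall n, L1 P (g n)) ->
  (forall e, 0 < e -> exists N, forall k n, (N <= k)%N -> (N <= n)%N ->
     \int[P]_x `|g k x - g n x| <= e) ->
  exists s : nat -> nat, (forall j, (j <= s j)%N) /\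
    {ae P, forall x, cvgn (fun j => g (s j) x)}.
Proof.
move=> Lg cauchy.
have /choice[N NP] : forall j, exists N, forall k n, (N <= k)%N -> (N <= n)%N ->
    \int[P]_x `|g k x - g n x| <= 1 / (2 ^ j.+1)%:R.
  by move=> j; apply: cauchy; rewrite divr_gt0// ltr0n expn_gt0.
pose s := fix s j := if j is i.+1 then maxn (N j) (s i).+1 else N 0%N.
have Ns j : (N j <= s j)%N by case: j => //= j; exact: leq_maxl.
have sS j : (s j < s j.+1)%N by rewrite /= leq_maxr.
exists s; split; first by elim=> // j ih; exact: leq_ltn_trans (sS j).
pose dist j x := `|g (s j.+1) x - g (s j) x|.
have Ld j : L1 P (dist j) by apply: L1_norm; exact: L1B.
have md j : measurable_fun setT (fun x => (dist j x)%:E) := measurable_int _ (Ld j).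
have sumfin : (\int[P]_x (\sum_(j <oo) (dist j x)%:E) < +oo)%E.
  rewrite integral_nneseries; [|by []|exact: md|by move=> j x _; rewrite lee_fin normr_ge0].
  apply: (@le_lt_trans _ _ (\sum_(j <oo) (cst 0 j + (1 / (2 ^ j.+1)%:R)%:E))%E).
    apply: lee_nneseries => [j _ _|j _].
      by rewrite integral_ge0// => x _; rewrite lee_fin normr_ge0.
    rewrite /cst add0e -EFin_Rintegral// lee_fin; apply: NP => //.
    by apply: leq_trans (Ns j) (ltnW (sS j)).
  apply: (le_lt_trans (epsilon_trick _ _ _)) => //.
  by rewrite eseries0 ?add0e ?ltry.
have : P.-integrable setT (fun x => \sum_(j <oo) (dist j x)%:E)%E.
  apply/integrableP; split.
    apply: ge0_emeasurable_sum => [j x _ _|j _]; last exact: md.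
    by rewrite lee_fin normr_ge0.
  under eq_integral => x _.
    rewrite gee0_abs; last by apply: nneseries_ge0 => j _ _; rewrite lee_fin normr_ge0.
    over.
  by [].
move=> /integrable_ae-/(_ measurableT); apply: filterS => x /(_ I) sumx.
pose u j := g (s j) x.
have : cvgn (series (telescope u)).
  apply: normed_cvg; apply: nondecreasing_is_cvgn.
    by apply: nondecreasing_series => j _ _ /=.
  exists (fine (\sum_(j <oo) (dist j x)%:E)%E) => _ [n _ <-].
  rewrite -lee_fin fineK// /series /= -sumEFin.
  by apply: nneseries_lim_ge => j _; rewrite lee_fin normr_ge0.
rewrite telescopeK => /cvg_ex[l ul]; apply/cvg_ex; exists (l + u 0%N).
rewrite (_ : (fun j => _) = (fun n => (u n - u 0%N) + u 0%N)).
  by apply: cvgD => //; exact: cvg_cst.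
by apply/funext => j; rewrite subrK.
Qed.

End almost_everywhere_limits.

(** * Comparing two Gibbs densities pointwise *)

Section pointwise_estimate.
Context {R : realType}.
Implicit Types (M s eta : R).

Definition clip M (x : R) := Num.max (- M) (Num.min x M).

Lemma clip_norm M x : 0 <= M -> `|clip M x| <= M.
Proof.
move=> M0; rewrite ler_norml /clip le_max lexx /=.
by rewrite ge_max ge_min lexx orbT andbT; lra.
Qed.

Lemma clip_id M x : `|x| <= M -> clip M x = x.
Proof.
rewrite ler_norml => /andP[Mx xM]; rewrite /clip; have -> : Num.min x M = x by exact/min_idPl.
exact/max_idPr.
Qed.

Lemma clipN M x : 0 <= M -> clip M (- x) = - clip M x.
Proof.
move=> M0; rewrite /clip.
have [xM|xM] := leP x M; have [nxM|nxM] := leP (- x) M.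
- by have [] := leP (- M) x; have [] := leP (- M) (- x); lra.
- by have [] := leP (- M) x; have [] := leP (- M) M; lra.
- by have [] := leP (- M) M; have [] := leP (- M) (- x); lra.
- by have [] := leP (- M) M; lra.
Qed.

Lemma le_clip M x y : x <= y -> clip M x <= clip M y.
Proof.
move=> xy; rewrite /clip ge_max le_max lexx /= le_max.
by rewrite [X in _ || X](_ : _ = true) ?orbT// le_min !ge_min xy lexx orbT.
Qed.

Lemma measurable_clip M : measurable_fun [set: R] (clip M).
Proof. by apply: measurable_maxr => //; exact: measurable_minr. Qed.

(** As [clip] is odd and monotone, clip f + clip g = clip f - clip (- g) has the
    sign of f - (- g) = u - v, which is also the sign of expR u - expR v. *)
Lemma expRB_clip_ge0 M (u v f g : R) : 0 <= M -> u - v = f + g ->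
  0 <= (expR u - expR v) * (clip M f + clip M g).
Proof.
move=> M0; wlog vu : u v f g / v <= u => [hw uvfg|uvfg].
  have [/hw|/ltW uv] := leP v u; first exact.
  have := hw v u (- f) (- g) uv; rewrite !clipN//.
  have -> : v - u = - f - g by lra.
  by move=> /(_ erefl); lra.
apply: mulr_ge0; first by rewrite subr_ge0 ler_expR.
by rewrite -[g]opprK (clipN _ M0) subr_ge0 le_clip//; lra.
Qed.

(** The exponential is [S]-Lipschitz where it is at most [S]. *)
Lemma sqr_expRB_le (u v S : R) : expR u <= S -> expR v <= S ->
  (expR u - expR v) ^+ 2 <= S * ((expR u - expR v) * (u - v)).
Proof.
wlog vu : u v / v <= u => [hw uS vS|uS vS].
  have [/hw|/ltW uv] := leP v u; first exact.
  by have := hw v u uv vS uS; lra.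
have e0 : 0 <= expR u - expR v by rewrite subr_ge0 ler_expR.
have uv0 : 0 <= u - v by rewrite subr_ge0.
have : expR u - expR v <= expR u * (u - v).
  have -> : expR v = expR u * expR (v - u) by rewrite -expRD; congr expR; lra.
  have := expR_ge1Dx (v - u); have := expR_gt0 u; nra.
move=> /(fun h => ler_wpM2l e0 h); rewrite -expr2 => /le_trans; apply.
by rewrite mulrCA ler_wpM2r// mulr_ge0.
Qed.

(** The four terms correspond to four regions. Where C1 or C2 exceeds [s] the
    trivial bound a + b is absorbed by the last term. Elsewhere a and b are at
    most S = expR (2 s); if a difference of potentials exceeds [M], the bound S
    is absorbed by the third term. Otherwise [clip] is the identity and the
    second term dominates (a - b)^2 / eta, while |d| <= eta + d^2 / eta. *)
Lemma expRB_clip_le (f1 f2 g1 g2 w C1 C2 M s eta : R) :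
  0 < M -> 0 < s -> 0 < eta -> 0 <= w -> 0 <= C1 -> 0 <= C2 ->
  f1 <= C1 -> f2 <= C1 -> g1 <= C2 -> g2 <= C2 ->
  `|expR (f1 + g1 - w) - expR (f2 + g2 - w)| <= eta
    + expR (2 * s) / eta * ((expR (f1 + g1 - w) - expR (f2 + g2 - w)) *
                            (clip M (f1 - f2) + clip M (g1 - g2)))
    + expR (2 * s) / M * (`|f1 - f2| + `|g1 - g2|)
    + (expR (f1 + g1 - w) + expR (f2 + g2 - w)) *
      (Num.min 1 (C1 / s) + Num.min 1 (C2 / s)).
Proof.
move=> M0 s0 eta0 w0 C10 C20 f1C f2C g1C g2C.
set a := expR (f1 + g1 - w); set b := expR (f2 + g2 - w).
set S := expR (2 * s).
have a0 : 0 <= a := expR_ge0 _; have b0 : 0 <= b := expR_ge0 _.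
have S0 : 0 < S := expR_gt0 _.
have m1 : 0 <= Num.min 1 (C1 / s) by rewrite le_min ler01 divr_ge0// ltW.
have m2 : 0 <= Num.min 1 (C2 / s) by rewrite le_min ler01 divr_ge0// ltW.
have T2 : 0 <= S / eta * ((a - b) * (clip M (f1 - f2) + clip M (g1 - g2))).
  apply: mulr_ge0; first by rewrite divr_ge0// ltW.
  by apply: expRB_clip_ge0; [exact: ltW|lra].
have T3 : 0 <= S / M * (`|f1 - f2| + `|g1 - g2|).
  by apply: mulr_ge0; [rewrite divr_ge0// ltW|rewrite addr_ge0].
have T4 : 0 <= (a + b) * (Num.min 1 (C1 / s) + Num.min 1 (C2 / s)).
  by rewrite mulr_ge0 ?addr_ge0.
have tail : 1 <= Num.min 1 (C1 / s) + Num.min 1 (C2 / s) ->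
    `|a - b| <= (a + b) * (Num.min 1 (C1 / s) + Num.min 1 (C2 / s)).
  move=> h; apply: (@le_trans _ _ (a + b)); first by rewrite ler_norml; lra.
  by rewrite ler_peMr// addr_ge0.
have [sC1|C1s] := ltP s C1.
  have e : Num.min 1 (C1 / s) = 1.
    by apply/min_idPl; rewrite ler_pdivlMr// mul1r ltW.
  by have := tail; rewrite e lerDl => /(_ m2); rewrite e in T4 *; lra.
have [sC2|C2s] := ltP s C2.
  have e : Num.min 1 (C2 / s) = 1.
    by apply/min_idPl; rewrite ler_pdivlMr// mul1r ltW.
  by have := tail; rewrite e lerDr => /(_ m1); rewrite e in T4 *; lra.
have aS : a <= S by rewrite ler_expR; lra.
have bS : b <= S by rewrite ler_expR; lra.
have abS : `|a - b| <= S by rewrite ler_norml; lra.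
have [Mfg|fgM] := ltP M (`|f1 - f2| + `|g1 - g2|).
  have : S <= S / M * (`|f1 - f2| + `|g1 - g2|).
    by rewrite -mulrA ler_peMr ?(ltW S0)// ler_pdivlMl// mulr1 ltW.
  lra.
have := normr_ge0 (f1 - f2); have := normr_ge0 (g1 - g2) => g0 f0.
move: T2; rewrite !clip_id; [|lra|lra].
have -> : f1 - f2 + (g1 - g2) = (f1 + g1 - w) - (f2 + g2 - w) by lra.
have := sqr_expRB_le aS bS; rewrite -/a -/b; set D := S * _ => sqD T2.
suff : `|a - b| <= eta + D / eta.
  have -> : S / eta * ((a - b) * (f1 + g1 - w - (f2 + g2 - w))) = D / eta.
    by rewrite /D mulrAC.
  lra.
have [abe|eab] := leP `|a - b| eta.
  have D0 : 0 <= D := le_trans (sqr_ge0 _) sqD.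
  by have : 0 <= D / eta by [rewrite divr_ge0// ltW]; lra.
have : `|a - b| <= D / eta.
  rewrite ler_pdivlMr//; apply: le_trans sqD; rewrite -real_normK ?num_real//.
  by rewrite expr2 ler_wpM2l// ltW.
lra.
Qed.

End pointwise_estimate.

(** * Gibbs densities with converging marginals converge in L1 *)

Section gibbs_density.
Context (R : realType) (d1 d2 : measure_display).
Context (X : measurableType d1) (Y : measurableType d2) (c : X * Y -> R).

Definition gibbs_density (F : X -> R) (G : Y -> R) (z : X * Y) : R :=
  expR (F z.1 + G z.2 - c z).

Lemma measurable_gibbs_density (F : X -> R) (G : Y -> R) :
  measurable_fun setT c -> measurable_fun setT F -> measurable_fun setT G ->
  measurable_fun setT (gibbs_density F G).
Proof.
move=> mc mF mG; apply: measurableT_comp => //.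
by apply: measurable_funB => //; apply: measurable_funD; exact: measurableT_comp.
Qed.

End gibbs_density.

Section gibbs_densities.
Context (R : realType) (d1 d2 : measure_display).
Context (X : measurableType d1) (Y : measurableType d2).
Variables (mu : probability X R) (nu : probability Y R) (c : X * Y -> R).
Local Notation m := (mu \x nu)%E.

Variables (F : nat -> X -> R) (G : nat -> Y -> R) (h : nat -> X -> R).
Variables (C1 : X -> R) (C2 : Y -> R) (K : R).
(* [C1], [C2] and [K] are the a priori bounds on the potentials; the second
   marginal of every density is exactly [nu], the first one is [h k] times [mu]. *)
Hypotheses (mc : measurable_fun setT c) (c_ge0 : forall z, 0 <= c z).
Hypotheses (C1_ge0 : forall x, 0 <= C1 x) (C2_ge0 : forall y, 0 <= C2 y).
Hypotheses (LC1 : L1 mu C1) (LC2 : L1 nu C2).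
Hypotheses (LF : forall k, L1 mu (F k)) (LG : forall k, L1 nu (G k)).
Hypothesis FK : forall k, \int[mu]_x `|F k x| <= K.
Hypothesis GK : forall k, \int[nu]_y `|G k y| <= K.
Hypothesis FC : forall k, {ae mu, forall x, F k x <= C1 x}.
Hypothesis GC : forall k, {ae nu, forall y, G k y <= C2 y}.
Hypothesis Lh : forall k, L1 mu (h k).
Hypothesis fst_marginal : forall k, {ae mu, forall x,
  (\int[nu]_y (gibbs_density c (F k) (G k) (x, y))%:E = (h k x)%:E)%E}.
Hypothesis snd_marginal : forall k, {ae nu, forall y,
  (\int[mu]_x (gibbs_density c (F k) (G k) (x, y))%:E = 1)%E}.

Local Notation p k := (gibbs_density c (F k) (G k)).
Local Notation delta k := (\int[mu]_x `|h k x - 1|).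

Lemma measurable_gibbs k : measurable_fun setT (p k).
Proof. by apply: measurable_gibbs_density => //;
  [exact: L1_measurable (LF k)|exact: L1_measurable (LG k)]. Qed.

Lemma integral_gibbs_fst k (phi : X -> R) (M : R) : measurable_fun setT phi ->
  (forall x, `|phi x| <= M) ->
  L1 m (fun z => phi z.1 * p k z) /\
  \int[m]_z (phi z.1 * p k z) = \int[mu]_x (phi x * h k x).
Proof.
move=> mphi phiM; apply: integral_fst_marginal => //.
- exact: measurable_gibbs.
- by move=> z; exact: expR_ge0.
- exact: L1_boundedM phiM (Lh k).
Qed.

Lemma integral_gibbs_snd k (phi : Y -> R) (M : R) : measurable_fun setT phi ->
  (forall y, `|phi y| <= M) ->
  L1 m (fun z => phi z.2 * p k z) /\
  \int[m]_z (phi z.2 * p k z) = \int[nu]_y phi y.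
Proof.
move=> mphi phiM.
have -> : \int[nu]_y phi y = \int[nu]_y (phi y * cst 1 y).
  by apply: eq_Rintegral => y _; rewrite mulr1.
apply: integral_snd_marginal => //.
- exact: measurable_gibbs.
- by move=> z; exact: expR_ge0.
- exact: L1_boundedM phiM (L1_cst _ _).
Qed.

Lemma L1_gibbs k : L1 m (p k).
Proof.
have [] := @integral_gibbs_fst k (cst 1) 1; first exact: measurable_cst.
  by move=> x; rewrite normr1.
by under eq_fun do rewrite /cst mul1r.
Qed.

Lemma L1_delta k : L1 mu (fun x => `|h k x - 1|).
Proof. by apply: L1_norm; apply: L1B => //; exact: L1_cst. Qed.

(** Integrating [expRB_clip_le]: its clipped terms are functions of one variable,
    so only the marginals of the two densities enter their integrals. The tail
    terms are bounded by Markov's inequality under the marginals. *)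
Lemma gibbs_dist_le k n (M s eta : R) : 0 < M -> 0 < s -> 0 < eta ->
  \int[m]_z `|p k z - p n z| <= eta
    + expR (2 * s) / eta * (M * (delta k + delta n))
    + expR (2 * s) / M * (4 * K)
    + (2 / s * (\int[mu]_x C1 x + \int[nu]_y C2 y) + delta k + delta n).
Proof.
move=> M0 s0 eta0.
have mF j := L1_measurable (LF j); have mG j := L1_measurable (LG j).
pose phi x := clip M (F k x - F n x); pose psi y := clip M (G k y - G n y).
have mphi : measurable_fun setT phi.
  by apply: (measurableT_comp (measurable_clip M)); exact: measurable_funB.
have mpsi : measurable_fun setT psi.
  by apply: (measurableT_comp (measurable_clip M)); exact: measurable_funB.
have phiM x : `|phi x| <= M by rewrite clip_norm// ltW.
have psiM x : `|psi x| <= M by rewrite clip_norm// ltW.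
pose b1 x := Num.min 1 (C1 x / s); pose b2 y := Num.min 1 (C2 y / s).
have mb1 : measurable_fun setT b1.
  by apply: measurable_minr => //; apply: measurable_funM => //; exact: L1_measurable LC1.
have mb2 : measurable_fun setT b2.
  by apply: measurable_minr => //; apply: measurable_funM => //; exact: L1_measurable LC2.
have b1_ge0 x : 0 <= b1 x by rewrite le_min ler01 divr_ge0// ltW.
have b2_ge0 x : 0 <= b2 x by rewrite le_min ler01 divr_ge0// ltW.
have b1_le1 x : `|b1 x| <= 1 by rewrite ger0_norm// ge_min lexx.
have b2_le1 x : `|b2 x| <= 1 by rewrite ger0_norm// ge_min lexx.
pose E2 z := (phi z.1 * p k z - phi z.1 * p n z)
           + (psi z.2 * p k z - psi z.2 * p n z).
pose E3 (z : X * Y) := (`|F k z.1| + `|F n z.1|) + (`|G k z.2| + `|G n z.2|).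
pose E4 z := (b1 z.1 * p k z + b1 z.1 * p n z)
           + (b2 z.2 * p k z + b2 z.2 * p n z).
(* The [psi] part integrates to 0: both second marginals are [nu]. *)
have [L2 I2] : L1 m E2 /\ \int[m]_z E2 z <= M * (delta k + delta n).
  have [L11 I11] := integral_gibbs_fst k mphi phiM; have [L12 I12] := integral_gibbs_fst n mphi phiM.
  have [L21 I21] := integral_gibbs_snd k mpsi psiM; have [L22 I22] := integral_gibbs_snd n mpsi psiM.
  split; first by apply: L1D; exact: L1B.
  rewrite RintegralD//; [|exact: L1B|exact: L1B].
  rewrite !RintegralB// I21 I22 subrr addr0 I11 I12 -RintegralB//; last 2 first.
  - exact: L1_boundedM phiM (Lh k).
  - exact: L1_boundedM phiM (Lh n).
  rewrite -RintegralD//; [|exact: L1_delta|exact: L1_delta].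
  rewrite -RintegralZl//; last by apply: L1D; exact: L1_delta.
  apply: le_Rintegral => //.
  - by apply: L1B; [exact: L1_boundedM phiM (Lh k)|exact: L1_boundedM phiM (Lh n)].
  - by apply: L1Z; apply: L1D; exact: L1_delta.
  - move=> x _; rewrite -mulrBr; apply: le_trans (ler_norm _) _.
    rewrite normrM; apply: ler_pM => //.
    have -> : h k x - h n x = (h k x - 1) - (h n x - 1) by ring.
    exact: ler_normB.
have [L3 I3] : L1 m E3 /\ \int[m]_z E3 z <= 4 * K.
  have [L11 I11] := L1_fst nu (L1_norm (LF k)); have [L12 I12] := L1_fst nu (L1_norm (LF n)).
  have [L21 I21] := L1_snd mu (L1_norm (LG k)); have [L22 I22] := L1_snd mu (L1_norm (LG n)).
  split; first by apply: L1D; exact: L1D.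
  rewrite RintegralD//; [|exact: L1D|exact: L1D].
  rewrite !RintegralD// I11 I12 I21 I22.
  by have := FK k; have := FK n; have := GK k; have := GK n; lra.
have b1h j : \int[mu]_x (b1 x * h j x) <= 1 / s * \int[mu]_x C1 x + delta j.
  rewrite -RintegralZl// -RintegralD//; [|exact: L1Z|exact: L1_delta].
  apply: le_Rintegral => //.
  - exact: L1_boundedM b1_le1 (Lh j).
  - by apply: L1D; [exact: L1Z|exact: L1_delta].
  - move=> x _; have -> : b1 x * h j x = b1 x + b1 x * (h j x - 1) by ring.
    apply: lerD; first by rewrite ge_min mul1r mulrC lexx orbT.
    apply: le_trans (ler_norm _) _; rewrite normrM.
    by rewrite -[leRHS]mul1r ler_wpM2r.
have b2h : \int[nu]_y b2 y <= 1 / s * \int[nu]_y C2 y.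
  rewrite -RintegralZl//; apply: le_Rintegral => //.
  - exact: L1_bounded b2_le1.
  - exact: L1Z.
  - by move=> y _; rewrite ge_min mul1r mulrC lexx orbT.
have [L4 I4] : L1 m E4 /\ \int[m]_z E4 z <=
    2 / s * (\int[mu]_x C1 x + \int[nu]_y C2 y) + delta k + delta n.
  have [L11 I11] := integral_gibbs_fst k mb1 b1_le1; have [L12 I12] := integral_gibbs_fst n mb1 b1_le1.
  have [L21 I21] := integral_gibbs_snd k mb2 b2_le1; have [L22 I22] := integral_gibbs_snd n mb2 b2_le1.
  split; first by apply: L1D; exact: L1D.
  rewrite RintegralD//; [|exact: L1D|exact: L1D].
  rewrite !RintegralD// I11 I12 I21 I22.
  by have := b1h k; have := b1h n; lra.
have L2' : L1 m (fun z => expR (2 * s) / eta * E2 z) by exact: L1Z.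
have L3' : L1 m (fun z => expR (2 * s) / M * E3 z) by exact: L1Z.
have L12 : L1 m (fun z => eta + expR (2 * s) / eta * E2 z).
  by apply: L1D => //; exact: L1_cst.
have L123 : L1 m (fun z => eta + expR (2 * s) / eta * E2 z + expR (2 * s) / M * E3 z).
  exact: L1D.
apply: (@le_trans _ _ (\int[m]_z (eta + expR (2 * s) / eta * E2 z
    + expR (2 * s) / M * E3 z + E4 z))).
  apply: ae_le_Rintegral.
  - by apply: L1_norm; apply: L1B; exact: L1_gibbs.
  - exact: L1D.
  - have FC' : {ae m, forall z, F k z.1 <= C1 z.1 /\ F n z.1 <= C1 z.1}.
      by apply: filterS2 (ae_fst nu (FC k)) (ae_fst nu (FC n)) => z.
    have GC' : {ae m, forall z, G k z.2 <= C2 z.2 /\ G n z.2 <= C2 z.2}.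
      by apply: filterS2 (ae_snd mu (GC k)) (ae_snd mu (GC n)) => z.
    apply: filterS2 FC' GC' => z [FkC FnC] [GkC GnC].
    have := expRB_clip_le M0 s0 eta0 (c_ge0 z) (C1_ge0 _) (C2_ge0 _) FkC FnC GkC GnC.
    move/le_trans; apply; rewrite -/(phi z.1) -/(psi z.2) -/(b1 z.1) -/(b2 z.2).
    rewrite -/(p k z) -/(p n z).
    apply: lerD; [apply: lerD; [apply: lerD => //|]|].
    + rewrite [leLHS](_ : _ = expR (2 * s) / eta * E2 z)//; congr (_ * _).
      by rewrite /E2; ring.
    + apply: ler_wpM2l; first by rewrite divr_ge0 ?expR_ge0// ltW.
      by apply: lerD; exact: ler_normB.
    + by rewrite [leLHS](_ : _ = E4 z)// /E4; ring.
rewrite RintegralD// RintegralD// RintegralD//; last exact: L1_cst.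
rewrite RintegralZl// RintegralZl// Rintegral_prob_cst.
have Se : 0 <= expR (2 * s) / eta by rewrite divr_ge0 ?expR_ge0// ltW.
have SM : 0 <= expR (2 * s) / M by rewrite divr_ge0 ?expR_ge0// ltW.
apply: lerD => //; apply: lerD; last exact: ler_wpM2l.
by apply: lerD => //; exact: ler_wpM2l.
Qed.


Hypothesis delta_cvg0 : (fun k => delta k) @ \oo --> 0.

(** The parameters are fixed in the order [s], [eta], [M], each term of
    [gibbs_dist_le] being made at most e / 4; only then is [N] chosen so that the
    marginals are close enough. *)
Lemma gibbs_cauchy (e : R) : 0 < e ->
  exists N, forall k n, (N <= k)%N -> (N <= n)%N ->
    \int[m]_z `|p k z - p n z| <= e.
Proof.
move=> e0; set A := \int[mu]_x C1 x + \int[nu]_y C2 y.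
have A0 : 0 <= A by rewrite addr_ge0//; exact: Rintegral_ge0.
have K0 : 0 <= K by apply: le_trans (FK 0%N); exact: Rintegral_ge0.
pose s := 8 * A / e + 1.
have s0 : 0 < s by rewrite ltr_wpDl// divr_ge0 ?mulr_ge0// ltW.
pose S := expR (2 * s); have S0 : 0 < S := expR_gt0 _.
pose M := 16 * S * K / e + 1.
have M0 : 0 < M by rewrite ltr_wpDl// divr_ge0 ?mulr_ge0// ltW.
pose eta := e / 4; have eta0 : 0 < eta by rewrite divr_gt0.
pose L := S / eta * M + 1.
have L_ge1 : 1 <= L by rewrite lerDr mulr_ge0 ?divr_ge0// ltW.
have /cvgrPdist_le/(_ (e / 8 / L)) := delta_cvg0.
have L0 : 0 < L by lra.
have eL0 : 0 < e / 8 / L by rewrite !divr_gt0.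
move=> /(_ eL0) [N _ small]; exists N => k n Nk Nn.
have := small k Nk; have := small n Nn; rewrite !sub0r !normrN.
rewrite !ger0_norm; [|exact: Rintegral_ge0|exact: Rintegral_ge0] => dn dk.
apply: le_trans (gibbs_dist_le k n M0 s0 eta0) _; rewrite -/S -/A.
have T1 : S / M * (4 * K) <= e / 4.
  rewrite mulrAC ler_pdivrMr//.
  have -> : e / 4 * M = S * (4 * K) + e / 4 by rewrite /M; field; rewrite gt_eqF.
  by rewrite lerDl divr_ge0// ltW.
have T2 : 2 / s * A <= e / 4.
  rewrite mulrAC ler_pdivrMr//.
  have -> : e / 4 * s = 2 * A + e / 4 by rewrite /s; field; rewrite gt_eqF.
  by rewrite lerDl divr_ge0// ltW.
have T3 : L * (delta k + delta n) <= e / 4.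
  rewrite -ler_pdivlMl//; apply: le_trans (lerD dk dn) _.
  by rewrite le_eqVlt; apply/orP; left; apply/eqP; field; rewrite gt_eqF.
have -> : S / eta * (M * (delta k + delta n)) = (L - 1) * (delta k + delta n).
  by rewrite /L; ring.
rewrite -[leRHS](_ : eta + (e / 4) + e / 4 + (e / 4)  = e); last by rewrite /eta; field.
move: T1 T2 T3; lra.
Qed.

(** The potentials of the limit are obtained after adding a constant to [F k]
    and subtracting it from [G k], which leaves the density unchanged: the value
    of [G] at a fixed point [y0] turns the convergence of the sums on the slice
    y = y0 into that of the first potentials. *)
Lemma gibbs_limit : exists Fi Gi, [/\ L1 mu Fi, L1 nu Gi,
  L1 m (gibbs_density c Fi Gi) &
  forall e, 0 < e -> exists N, forall n, (N <= n)%N ->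
    \int[m]_z `|gibbs_density c Fi Gi z - p n z| <= e].
Proof.
have Lp := L1_gibbs.
have [s [sge scvg]] := L1_cauchy_subseq Lp gibbs_cauchy.
have [y0 [cvg_y0 [B GB]]] : exists y0, {ae mu, forall x, cvgn (fun j => p (s j) (x, y0))}
    /\ exists B, forall N, exists2 j, (N <= j)%N & `|G (s j) y0| <= B.
  apply: (@ae_exists _ _ _ nu).
  have frG := fatou_frequently_bounded (fun j => LG (s j)) (fun j => GK (s j)).
  by apply: filterS2 (ae_section_fst scvg) frG => y.
(* Boundedness of the shift along a subsequence preserves the L1 bounds. *)
have [t [tge tB]] := frequently_subseq GB.
pose r j := s (t j); have rge j : (j <= r j)%N := leq_trans (tge j) (sge (t j)).
pose F' j x := F (r j) x + G (r j) y0; pose G' j y := G (r j) y - G (r j) y0.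
have cvg_sub (u : nat -> R) : cvgn (fun j => u (s j)) -> cvgn (fun j => u (r j)).
  move=> /cvg_ex[l ul]; apply/cvg_ex; exists l.
  apply: (cvg_comp t (fun j => u (s j)) _ ul).
  by move=> Q [N _ NQ]; exists N => // j /= Nj; apply: NQ; exact: leq_trans (tge j).
have LF' j : L1 mu (F' j) by apply: L1D => //; exact: L1_cst.
have LG' j : L1 nu (G' j) by apply: L1B => //; exact: L1_cst.
have F'K j : \int[mu]_x `|F' j x| <= K + B.
  apply: (@le_trans _ _ (\int[mu]_x (`|F (r j) x| + B))).
    apply: le_Rintegral => //.
    - exact: L1_norm.
    - by apply: L1D; [exact: L1_norm|exact: L1_cst].
    - by move=> x _; apply: le_trans (ler_normD _ _) _; rewrite lerD2l; exact: tB.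
  rewrite RintegralD//; [|exact: L1_norm|exact: L1_cst].
  by rewrite Rintegral_prob_cst lerD2r.
have G'K j : \int[nu]_y `|G' j y| <= K + B.
  apply: (@le_trans _ _ (\int[nu]_y (`|G (r j) y| + B))).
    apply: le_Rintegral => //.
    - exact: L1_norm.
    - by apply: L1D; [exact: L1_norm|exact: L1_cst].
    - by move=> x _; apply: le_trans (ler_normB _ _) _; rewrite lerD2l; exact: tB.
  rewrite RintegralD//; [|exact: L1_norm|exact: L1_cst].
  by rewrite Rintegral_prob_cst lerD2r.
have [Fi LFi F'Fi] : exists2 g, L1 mu g &
    {ae mu, forall x, (fun j => F' j x) @ \oo --> g x}.
  apply: (L1_limit LF' F'K); apply: filterS cvg_y0 => x /(cvg_sub (fun i => p i (x, y0))).
  move=> /cvg_ex[l ul]; apply/cvg_ex; exists (l * expR (c (x, y0))).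
  rewrite (_ : (fun j => _) = fun j => p (r j) (x, y0) * expR (c (x, y0))).
    by apply: cvgM => //; exact: cvg_cst.
  by apply/funext => j; rewrite /gibbs_density -expRD /= subrK.
(* One more slice, at x = x0, separates the second potentials. *)
have [x0 [cvg_x0 F'x0]] : exists x0, {ae nu, forall y, cvgn (fun j => p (s j) (x0, y))}
    /\ (fun j => F' j x0) @ \oo --> Fi x0.
  apply: (@ae_exists _ _ _ mu).
  by apply: filterS2 (ae_section_snd scvg) F'Fi => x.
have [Gi LGi G'Gi] : exists2 g, L1 nu g &
    {ae nu, forall y, (fun j => G' j y) @ \oo --> g y}.
  apply: (L1_limit LG' G'K); apply: filterS cvg_x0 => y /(cvg_sub (fun i => p i (x0, y))).
  move=> /cvg_ex[l ul]; apply/cvg_ex.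
  exists (l * expR (c (x0, y)) * expR (- Fi x0)).
  rewrite (_ : (fun j => _) = fun j =>
      p (r j) (x0, y) * expR (c (x0, y)) * expR (- F' j x0)).
    apply: cvgM; first by apply: cvgM => //; exact: cvg_cst.
    by apply: continuous_cvg; [exact: continuous_expR|exact: cvgN].
  apply/funext => j; rewrite /gibbs_density -!expRD /=.
  by congr expR; rewrite /F' /G'; ring.
pose q := gibbs_density c Fi Gi.
have mq : measurable_fun setT q.
  by apply: measurable_gibbs_density => //;
    [exact: L1_measurable LFi|exact: L1_measurable LGi].
have pq : {ae m, forall z, (fun j => p (r j) z) @ \oo --> q z}.
  apply: filterS2 (ae_fst nu F'Fi) (ae_snd mu G'Gi) => z F'z G'z.
  rewrite (_ : (fun j => _) = fun j => expR (F' j z.1 + G' j z.2 - c z)).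
    apply: continuous_cvg; first exact: continuous_expR.
    by apply: cvgB; [exact: cvgD|exact: cvg_cst].
  by apply/funext => j; congr expR; rewrite /F' /G'; ring.
have fat e N : (forall k n, (N <= k)%N -> (N <= n)%N ->
      \int[m]_z `|p k z - p n z| <= e) ->
    forall n, (N <= n)%N -> (\int[m]_z `|q z - p n z|%:E <= e%:E)%E.
  move=> small n Nn.
  have mdist j : measurable_fun setT (fun z => `|p (r j) z - p n z|).
    by apply: (@L1_measurable _ _ _ m); apply: L1_norm; exact: L1B.
  apply: (@le_trans _ _
    (\int[m]_z limn_einf (fun j => `|p (r j) z - p n z|%:E))%E).
    apply: ae_le_integral.
    - apply/measurable_EFinP; apply: measurableT_comp => //.
      by apply: measurable_funB => //; exact: L1_measurable (Lp n).
    - apply: measurableT_comp => //; apply: measurable_fun_limn_esup => j.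
      by apply: measurableT_comp => //; exact/measurable_EFinP.
    - apply: filterS pq => z pqz.
      have /cvg_limn_einf_sup[-> _] :
          (fun j => `|p (r j) z - p n z|%:E) @ \oo --> `|q z - p n z|%:E.
        apply: cvg_EFin; first exact: nearW.
        by apply: cvg_norm; apply: cvgB => //; exact: cvg_cst.
      by [].
  apply: (@fatou_bound _ _ _ m (fun j z => `|p (r j) z - p n z|) e N) => // j Nj.
  rewrite -EFin_Rintegral; last by apply: L1_norm; exact: L1B.
  by rewrite lee_fin; apply: small => //; exact: leq_trans (rge j).
have Lq : L1 m q.
  have [N small] := gibbs_cauchy ltr01.
  rewrite (_ : q = fun z => (q z - p N z) + p N z); last first.
    by apply/funext => z; rewrite subrK.
  apply: L1D => //; have mqp : measurable_fun setT (fun z => q z - p N z).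
    by apply: measurable_funB => //; exact: L1_measurable (Lp N).
  apply/integrableP; split; first exact/measurable_EFinP.
  exact: le_lt_trans (fat _ _ small N (leqnn N)) (ltry _).
exists Fi, Gi; split => // e e0.
have [N small] := gibbs_cauchy e0; exists N => n Nn.
by rewrite -lee_fin EFin_Rintegral; [exact: fat Nn|apply: L1_norm; exact: L1B].
Qed.

Section limit_marginals.
Variable q : X * Y -> R.
Hypothesis Lq : L1 m q.
Hypothesis pq : forall e, 0 < e -> exists N, forall n, (N <= n)%N ->
  \int[m]_z `|q z - p n z| <= e.

Let dist_le (phi : X * Y -> R) n : measurable_fun setT phi ->
  (forall z, `|phi z| <= 1) ->
  `|\int[m]_z (phi z * q z) - \int[m]_z (phi z * p n z)|
    <= \int[m]_z `|q z - p n z|.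
Proof.
move=> mphi phi1; have Lp := L1_gibbs n.
have Lphiq := L1_boundedM mphi phi1 Lq; have Lphip := L1_boundedM mphi phi1 Lp.
rewrite -RintegralB//; apply: le_trans (le_normr_Rintegral _ _) _ => //.
  exact: L1B.
apply: le_Rintegral => //.
- by apply: L1_norm; exact: L1B.
- by apply: L1_norm; exact: L1B.
- by move=> z _; rewrite -mulrBr normrM -[leRHS]mul1r ler_wpM2r.
Qed.

Lemma limit_fst_marginal (phi : X -> R) : measurable_fun setT phi ->
  (forall x, `|phi x| <= 1) ->
  \int[m]_z (phi z.1 * q z) = \int[mu]_x phi x.
Proof.
move=> mphi phi1; apply/eqP; rewrite -subr_eq0 -normr_le0.
apply/ler_addgt0Pl => e e0; rewrite addr0.
have [N1 pqe] := pq (divr_gt0 e0 (ltr0Sn R 1)).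
have /cvgrPdist_le/(_ _ (divr_gt0 e0 (ltr0Sn R 1)))[N2 _ de] := delta_cvg0.
pose n := maxn N1 N2.
have := pqe n (leq_maxl _ _); have := de n (leq_maxr _ _).
rewrite sub0r normrN ger0_norm; last exact: Rintegral_ge0.
have mphi' : measurable_fun setT (fun z : X * Y => phi z.1) by exact: measurableT_comp.
have := @dist_le (fun z => phi z.1) n mphi' (fun z => phi1 z.1).
have [_ ->] := integral_gibbs_fst n mphi phi1.
have : `|\int[mu]_x (phi x * h n x) - \int[mu]_x phi x| <= delta n.
  have Lphi : L1 mu phi by exact: L1_bounded phi1.
  have Lphih := L1_boundedM mphi phi1 (Lh n).
  rewrite -RintegralB//; apply: le_trans (le_normr_Rintegral _ _) _ => //.
    exact: L1B.
  apply: le_Rintegral => //; [by apply: L1_norm; exact: L1B|exact: L1_delta|].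
  move=> x _; have -> : phi x * h n x - phi x = phi x * (h n x - 1) by ring.
  by rewrite normrM -[leRHS]mul1r ler_wpM2r.
move=> h1 h2 h3 h4; apply: le_trans (ler_distD (\int[mu]_x (phi x * h n x)) _ _) _.
move: h1 h2 h3 h4; lra.
Qed.

Lemma limit_snd_marginal (phi : Y -> R) : measurable_fun setT phi ->
  (forall y, `|phi y| <= 1) ->
  \int[m]_z (phi z.2 * q z) = \int[nu]_y phi y.
Proof.
move=> mphi phi1; apply/eqP; rewrite -subr_eq0 -normr_le0.
apply/ler_addgt0Pl => e e0; rewrite addr0.
have [N pqe] := pq e0.
have mphi' : measurable_fun setT (fun z : X * Y => phi z.2) by exact: measurableT_comp.
have := @dist_le (fun z => phi z.2) N mphi' (fun z => phi1 z.2).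
have [_ ->] := integral_gibbs_snd N mphi phi1.
by move=> /le_trans; apply; exact: pqe.
Qed.

End limit_marginals.

End gibbs_densities.

(** * One half step of Sinkhorn's algorithm *)

Section soft_transform.
Context (R : realType) (d1 d2 : measure_display).
Context (X : measurableType d1) (Y : measurableType d2).
Variables (mu : probability X R) (nu : probability Y R) (c : X * Y -> R).

(** The entropic c-transform: a soft minimum over [x] of c (x, y) - F x. *)
Definition soft_transform (F : X -> R) (y : Y) : R :=
  - ln (\int[mu]_x expR (F x - c (x, y))).

Lemma integral_expR_gt0 (f : X -> R) : measurable_fun setT f ->
  (0 < \int[mu]_x (expR (f x))%:E)%E.
Proof.
move=> mf; rewrite lt0e integral_ge0 ?andbT//.
apply/negP => /eqP h0.
have mexp : measurable_fun setT (fun x => (expR (f x))%:E).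
  by apply/measurable_EFinP; exact: measurableT_comp.
have /(ae_eq_integral_abs mu measurableT) [h _] := mexp.
have := h.
under eq_integral do rewrite gee0_abs ?lee_fin ?expR_ge0//.
move=> /(_ h0)/filterS ae0.
have [x /=] : exists x, expR (f x) = 0.
  by apply: (@ae_exists _ _ _ mu); apply: ae0 => x /(_ I) /= [].
by move/eqP; rewrite gt_eqF// expR_gt0.
Qed.

(** Let G be the transform of F. The hypothesis on [G0], the previous potential,
    bounds the mass of exp (F + G0 - c) by 1. Since exp (G0 - G) is the density
    of its [y]-marginal, this mass bound makes G finite almost everywhere, and
    G >= G0 + 1 - exp (G0 - G) then gives both integrability and the
    monotonicity of the integral. The upper bound is Jensen's inequality, in the
    form 1 + u <= exp u integrated over [x]. *)
Lemma soft_transformP (F : X -> R) (G0 C : Y -> R) :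
  measurable_fun setT c -> L1 mu F -> 0 <= \int[mu]_x F x -> L1 nu G0 ->
  L1 nu C ->
  {ae nu, forall y, L1 mu (fun x => c (x, y)) /\ \int[mu]_x c (x, y) = C y} ->
  (\int[nu]_y \int[mu]_x (expR (F x + G0 y - c (x, y)))%:E <= 1)%E ->
  let G := soft_transform F in
  [/\ [/\ L1 nu G, \int[nu]_y G0 y <= \int[nu]_y G y &
          {ae nu, forall y, G y <= C y}],
      {ae nu, forall y, (\int[mu]_x (expR (F x + G y - c (x, y)))%:E = 1)%E},
      {ae nu, forall y, sinkhorn_Y mu c (EFin \o F) y = (G y)%:E} &
      (\int[nu]_y (expR (G0 y - G y))%:E <= 1)%E].
Proof.
move=> mc LF F0 LG0 LC cC mass1 G.
have mF := L1_measurable LF; have mG0 := L1_measurable LG0.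
pose S y := (\int[mu]_x (expR (F x - c (x, y)))%:E)%E.
have mk : measurable_fun setT (fun z : X * Y => (expR (F z.1 - c z))%:E).
  apply/measurable_EFinP; apply: measurableT_comp => //.
  by apply: measurable_funB => //; exact: measurableT_comp.
have mS : measurable_fun setT S.
  by apply: (measurable_fun_fubini_tonelli_G _ mk) => z; rewrite lee_fin expR_ge0.
have S_gt0 y : (0 < S y)%E.
  apply: integral_expR_gt0; apply: measurable_funB => //.
  exact: measurable_section_fst.
have shift k y : (\int[mu]_x (expR (F x + k - c (x, y)))%:E = (expR k)%:E * S y)%E.
  rewrite -ge0_integralZl_EFin//.
  - by apply: eq_integral => x _; rewrite -EFinM -expRD; congr (expR _)%:E; ring.
  exact: (measurableT_comp mk (measurable_pair2 y)).
have mass1' : (\int[nu]_y ((expR (G0 y))%:E * S y) <= 1)%E.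
  by under eq_integral do rewrite -shift.
have mGS : measurable_fun setT (fun y => ((expR (G0 y))%:E * S y)%E).
  apply: emeasurable_funM => //; apply/measurable_EFinP.
  exact: measurableT_comp.
have Sfin : {ae nu, forall y, S y = (expR (- G y))%:E}.
  have : nu.-integrable setT (fun y => ((expR (G0 y))%:E * S y)%E).
    apply/integrableP; split => //.
    under eq_integral do rewrite gee0_abs ?mule_ge0 ?lee_fin ?expR_ge0 1?ltW//.
    exact: le_lt_trans mass1' (ltry 1).
  move=> /integrable_ae-/(_ measurableT); apply: filterS => y /(_ I).
  move: (S_gt0 y); rewrite /G /soft_transform /Rintegral -/(S y).
  case: (S y) => [s| |] //=; last first.
    by rewrite mulry gtr0_sg ?expR_gt0// mul1e.
  by rewrite lte_fin => s0 _; rewrite opprK lnK.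
have mG : measurable_fun setT G.
  apply: measurableT_comp => //; apply: measurableT_comp => //.
  exact: (measurableT_comp _ mS).
have hG : {ae nu, forall y, (\int[mu]_x (expR (F x + G y - c (x, y)))%:E = 1)%E}.
  by apply: filterS Sfin => y Sy; rewrite shift Sy -EFinM -expRD subrr expR0.
have hsink : {ae nu, forall y, sinkhorn_Y mu c (EFin \o F) y = (G y)%:E}.
  apply: filterS Sfin => y; rewrite /S /sinkhorn_Y /= => ->.
  by rewrite lne_EFin ?expR_gt0// expRK EFinN oppeK.
have mh : measurable_fun setT (fun y => expR (G0 y - G y)).
  by apply: measurableT_comp => //; exact: measurable_funB.
have h1 : (\int[nu]_y (expR (G0 y - G y))%:E <= 1)%E.
  apply: le_trans mass1'; apply: ae_le_integral => //.
    exact/measurable_EFinP.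
  by apply: filterS Sfin => y ->; rewrite -EFinM -expRD.
have Lh : L1 nu (fun y => expR (G0 y - G y)).
  apply: ge0_L1 => //.
  exact: le_lt_trans h1 (ltry 1).
(* Integrate 1 + u <= exp u for u = F x + G y - c (x, y). *)
have GC : {ae nu, forall y, G y <= C y}.
  apply: filterS2 hG cC => y Gy [Lc <-].
  have LGy : L1 mu (fun x => F x + G y - c (x, y)).
    by apply: L1B => //; apply: L1D => //; exact: L1_cst.
  have Lexp : L1 mu (fun x => expR (F x + G y - c (x, y))).
    apply: ge0_L1; rewrite ?Gy ?ltry//.
    exact: measurableT_comp (L1_measurable LGy).
  have : \int[mu]_x (1 + (F x + G y - c (x, y))) <= 1.
    rewrite -[leRHS]/(fine 1%E) -Gy; apply: le_Rintegral => //.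
      by apply: L1D => //; exact: L1_cst.
    by move=> x _; exact: expR_ge1Dx.
  rewrite RintegralD//; last exact: L1_cst.
  rewrite RintegralB//; last by apply: L1D => //; exact: L1_cst.
  rewrite RintegralD//; last exact: L1_cst.
  rewrite !Rintegral_prob_cst; lra.
have lowG y : G0 y + 1 - expR (G0 y - G y) <= G y.
  by have := expR_ge1Dx (G0 y - G y); lra.
have Llow : L1 nu (fun y => G0 y + 1 - expR (G0 y - G y)).
  by apply: L1B => //; apply: L1D => //; exact: L1_cst.
have LG : L1 nu G.
  apply: (@L1_le_ae _ _ _ _ _
    (fun y => `|G0 y + 1 - expR (G0 y - G y)| + `|C y|)) => //.
    by apply: L1D; exact: L1_norm.
  apply: filterS GC => y GCy; rewrite ler_norml; have := lowG y.
  have := ler_norm (C y); have := ler_norm (- (G0 y + 1 - expR (G0 y - G y))).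
  rewrite normrN; have := normr_ge0 (C y).
  have := normr_ge0 (G0 y + 1 - expR (G0 y - G y)); lra.
split => //; split => //.
have : \int[nu]_y (G0 y + 1 - expR (G0 y - G y)) <= \int[nu]_y G y.
  by apply: le_Rintegral => // y _; exact: lowG.
rewrite RintegralB//; last by apply: L1D => //; exact: L1_cst.
rewrite RintegralD//; last exact: L1_cst.
rewrite Rintegral_prob_cst.
have : \int[nu]_y expR (G0 y - G y) <= 1.
  by rewrite -lee_fin EFin_Rintegral.
lra.
Qed.

End soft_transform.

(** * The Sinkhorn potentials *)

Section extended_exponential.
Context {R : realType}.

(** [expeR] and [lne] agree with their real counterparts away from explicit
    measurable sets. *)
Lemma measurable_expeR : measurable_fun [set: \bar R] (@expeR R).
Proof.
have -> : @expeR R = fun x => if x == +oo%E then +oo%E else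
    if x == -oo%E then 0%E else (expR (fine x))%:E.
  by apply/funext; case.
apply: measurable_fun_ifT => //; first exact: measurable_fun_eqe.
apply: measurable_fun_ifT => //; first exact: measurable_fun_eqe.
by apply/measurable_EFinP; apply: measurableT_comp => //; exact: measurable_fine.
Qed.

Lemma measurable_lne : measurable_fun [set: \bar R] (@lne R).
Proof.
have -> : @lne R = fun x => if x == +oo%E then +oo%E else
    if (x <= 0)%E then -oo%E else (ln (fine x))%:E.
  by apply/funext; case=> [r||] //=; rewrite ?lee_fin ?leNye.
apply: measurable_fun_ifT => //; first exact: measurable_fun_eqe.
apply: measurable_fun_ifT => //; first exact: measurable_fun_lee.
by apply/measurable_EFinP; apply: measurableT_comp => //; exact: measurable_fine.
Qed.

End extended_exponential.

Section sinkhorn_transform.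
Context (R : realType) (d1 d2 : measure_display).
Context (X : measurableType d1) (Y : measurableType d2).
Variables (mu : probability X R) (c : X * Y -> R).
Hypothesis mc : measurable_fun setT c.

Lemma measurable_expeR_kernel (phi : X -> \bar R) : measurable_fun setT phi ->
  measurable_fun setT (fun z : X * Y => expeR (phi z.1 - (c z)%:E)).
Proof.
move=> mphi; apply: (measurableT_comp measurable_expeR).
apply: emeasurable_funB; first exact: measurableT_comp.
exact/measurable_EFinP.
Qed.

Lemma measurable_sinkhorn_Y (phi : X -> \bar R) : measurable_fun setT phi ->
  measurable_fun setT (sinkhorn_Y mu c phi).
Proof.
move=> mphi; apply: measurableT_comp => //.
apply: (measurableT_comp measurable_lne).
apply: (measurable_fun_fubini_tonelli_G _ (measurable_expeR_kernel mphi)).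
by move=> z; exact: expeR_ge0.
Qed.

Lemma eq_sinkhorn_Y (phi phi' : X -> \bar R) :
  measurable_fun setT phi -> measurable_fun setT phi' ->
  {ae mu, forall x, phi x = phi' x} ->
  sinkhorn_Y mu c phi = sinkhorn_Y mu c phi'.
Proof.
move=> mphi mphi' e; apply/funext => y; congr (- lne _)%E.
apply: ae_eq_integral => //.
- exact: (measurableT_comp (measurable_expeR_kernel mphi) (measurable_pair2 y)).
- exact: (measurableT_comp (measurable_expeR_kernel mphi') (measurable_pair2 y)).
- by apply: filterS e => x + _ => ->.
Qed.

End sinkhorn_transform.

Section sinkhorn_potentials.
Context (R : realType) (d1 d2 : measure_display).
Context (X : measurableType d1) (Y : measurableType d2).
Variables (mu : probability X R) (nu : probability Y R) (c : X * Y -> R).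
Local Notation m := (mu \x nu)%E.

Definition transposed_cost (z : Y * X) : R := c (z.2, z.1).

(** Real versions of the Sinkhorn potentials. The step on [X] is the step on [Y]
    for the transposed cost, so one lemma covers both. *)
Fixpoint potential_X (t : nat) : X -> R :=
  if t is s.+1
  then soft_transform nu transposed_cost (soft_transform mu c (potential_X s))
  else cst 0.

Definition potential_Y (t : nat) : Y -> R := soft_transform mu c (potential_X t).

Local Notation F := potential_X.
Local Notation G := potential_Y.

Hypothesis c_ge0 : forall z, 0 <= c z.
Hypothesis Lc : L1 m c.

Let mc : measurable_fun setT c. Proof. exact: L1_measurable Lc. Qed.
Let mcs : measurable_fun setT transposed_cost.
Proof.
by apply: (measurableT_comp mc); exact: measurable_fun_pair.
Qed.

Definition cost_X x := \int[nu]_y c (x, y).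
Definition cost_Y y := \int[mu]_x c (x, y).

Lemma cost_X_ge0 x : 0 <= cost_X x.
Proof. exact: Rintegral_ge0. Qed.

Lemma cost_Y_ge0 y : 0 <= cost_Y y.
Proof. exact: Rintegral_ge0. Qed.

Lemma L1_cost_X : L1 mu cost_X.
Proof. exact: (L1_fine (integrable_fubini_F Lc)). Qed.

Lemma L1_cost_Y : L1 nu cost_Y.
Proof.
have LG : nu.-integrable setT (fubini_G mu (EFin \o c)).
  apply/integrableP; split; first exact: (measurable_fubini_G Lc).
  rewrite (eq_integral (fubini_G mu (EFin \o c))); last first.
    by move=> y _; rewrite gee0_abs// integral_ge0// => x _; rewrite lee_fin.
  rewrite (integral21_prod_meas1 Lc).
  exact: integrable_lty Lc.
exact: (L1_fine LG).
Qed.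

Lemma ae_cost_X : {ae mu, forall x, L1 nu (fun y => transposed_cost (y, x)) /\
  \int[nu]_y transposed_cost (y, x) = cost_X x}.
Proof. by have := ae_integrable1 Lc; apply: filterS => x Lcx. Qed.

Lemma ae_cost_Y : {ae nu, forall y, L1 mu (fun x => c (x, y)) /\
  \int[mu]_x c (x, y) = cost_Y y}.
Proof. by have := ae_integrable2 Lc; apply: filterS => x Lcx. Qed.

(** The invariant that [soft_transformP] needs to perform the next half step. At
    t = 0 the witness [G0] is 0; later it is the preceding potential on [Y]. *)
Definition admissible t := [/\ L1 mu (F t), 0 <= \int[mu]_x F t x &
  exists G0 : Y -> R, [/\ L1 nu G0, 0 <= \int[nu]_y G0 y &
  (\int[nu]_y \int[mu]_x (expR (F t x + G0 y - c (x, y)))%:E <= 1)%E]].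

Lemma admissible0 : admissible 0.
Proof.
split; [exact: L1_cst|by rewrite Rintegral_prob_cst|].
exists (cst 0); split; [exact: L1_cst|by rewrite Rintegral_prob_cst|].
have le1 d (T : measurableType d) (P : probability T R) (f : T -> \bar R) :
    measurable_fun setT f -> (forall x, 0 <= f x <= 1)%E -> (\int[P]_x f x <= 1)%E.
  move=> mf f01; apply: (@le_trans _ _ (\int[P]_x cst 1%E x)%E).
    by apply: ge0_le_integral => // x _; have /andP[] := f01 x.
  by rewrite integral_prob1.
have mk : measurable_fun setT (fun z : X * Y => (expR (0 + 0 - c z))%:E).
  apply/measurable_EFinP; apply: measurableT_comp => //.
  exact: measurable_funB.
have inner y : (0 <= \int[mu]_x (expR (0 + 0 - c (x, y)))%:E <= 1)%E.
  rewrite integral_ge0//=; apply: le1.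
    exact: (measurableT_comp mk (measurable_pair2 y)).
  move=> x; rewrite !lee_fin expR_ge0 -expR0 ler_expR; have := c_ge0 (x, y); lra.
apply: le1 => //.
exact: (measurable_fun_fubini_tonelli_G _ mk).
Qed.

Lemma half_step_Y t : admissible t ->
  [/\ [/\ L1 nu (G t), 0 <= \int[nu]_y G t y &
          {ae nu, forall y, G t y <= cost_Y y}],
      {ae nu, forall y, (\int[mu]_x (expR (F t x + G t y - c (x, y)))%:E = 1)%E} &
      {ae nu, forall y, sinkhorn_Y mu c (EFin \o F t) y = (G t y)%:E}].
Proof.
move=> [LF F0 [G0 [LG0 G00 mass]]].
have [[LG GG0 GC] mG sG _] :=
  soft_transformP mc LF F0 LG0 L1_cost_Y ae_cost_Y mass.
by split => //; split => //; exact: le_trans GG0.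
Qed.

Lemma half_step_X t : admissible t ->
  [/\ [/\ L1 mu (F t.+1), \int[mu]_x F t x <= \int[mu]_x F t.+1 x &
          {ae mu, forall x, F t.+1 x <= cost_X x}],
      {ae mu, forall x, (\int[nu]_y (expR (F t.+1 x + G t y - c (x, y)))%:E = 1)%E},
      {ae mu, forall x, sinkhorn_X nu c (EFin \o G t) x = (F t.+1 x)%:E} &
      (\int[mu]_x (expR (F t x - F t.+1 x))%:E <= 1)%E].
Proof.
move=> /[dup] -[LF F0 _] /half_step_Y[[LG G0 _] mG _].
have mp := measurable_gibbs_density mc (L1_measurable LF) (L1_measurable LG).
have mass : (\int[mu]_x \int[nu]_y
    (expR (G t y + F t x - transposed_cost (y, x)))%:E <= 1)%E.
  under eq_integral do under eq_integral do rewrite [G t _ + _]addrC.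
  rewrite (sfinite_Fubini mu nu (fun z => (expR (F t z.1 + G t z.2 - c z))%:E))//=.
  - rewrite (ae_eq_integral (cst 1%E))//=.
    + by rewrite integral_prob1.
    + apply: (measurable_fun_fubini_tonelli_G
        (fun z => (expR (F t z.1 + G t z.2 - c z))%:E)) => //.
      exact/measurable_EFinP.
    + by apply: filterS mG => y -> _.
  - exact/measurable_EFinP.
have [[LF' FF' FC] mF sF hF] :=
  soft_transformP mcs LG G0 LF L1_cost_X ae_cost_X mass.
have mF' : {ae mu, forall x, (\int[nu]_y (expR
    (soft_transform nu transposed_cost (G t) x + G t y - c (x, y)))%:E = 1)%E}.
  apply: filterS mF => x <-; apply: eq_integral => y _.
  by rewrite [G t y + _]addrC.
have FE : F t.+1 = soft_transform nu transposed_cost (G t) by [].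
rewrite FE; split; [exact: And3|exact: mF'|exact: sF|exact: hF].
Qed.

Lemma admissibleP t : admissible t.
Proof.
elim: t => [|t /[dup] adt /half_step_X[[LF F01 _] mF _ _]]; first exact: admissible0.
have [_ F0 _] := adt.
have [[LG G0 _] _ _] := half_step_Y adt.
split => //; first exact: le_trans F01.
exists (G t); split => //.
have mp := measurable_gibbs_density mc (L1_measurable LF) (L1_measurable LG).
rewrite -(sfinite_Fubini mu nu (fun z => (expR (F t.+1 z.1 + G t z.2 - c z))%:E))//=.
- rewrite (ae_eq_integral (cst 1%E))//=.
  + by rewrite integral_prob1.
  + apply: (measurable_fun_fubini_tonelli_F
        (fun z => (expR (F t.+1 z.1 + G t z.2 - c z))%:E)) => //.
      exact/measurable_EFinP.
  + by apply: filterS mF => y -> _.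
- exact/measurable_EFinP.
Qed.

Lemma L1_potential_X t : L1 mu (F t).
Proof. by have [] := admissibleP t. Qed.

Lemma L1_potential_Y t : L1 nu (G t).
Proof. by have [[]] := half_step_Y (admissibleP t). Qed.

Lemma potential_X_le_cost t : {ae mu, forall x, F t x <= cost_X x}.
Proof.
case: t => [|t]; last by have [[]] := half_step_X (admissibleP t).
by apply: aeW => x; exact: cost_X_ge0.
Qed.

Lemma potential_Y_le_cost t : {ae nu, forall y, G t y <= cost_Y y}.
Proof. by have [[]] := half_step_Y (admissibleP t). Qed.

(** The extended real potentials may be infinite on null sets. As an integral
    does not see a null set, replacing a potential by its real version leaves
    the next transform unchanged at every point. *)
Lemma sinkhorn_phi_psiE t :
  [/\ measurable_fun setT (sinkhorn_phi mu nu c t),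
    {ae mu, forall x, sinkhorn_phi mu nu c t x = (F t x)%:E},
    measurable_fun setT (sinkhorn_psi mu nu c t) &
    {ae nu, forall y, sinkhorn_psi mu nu c t y = (G t y)%:E}].
Proof.
have half s : measurable_fun setT (sinkhorn_phi mu nu c s) ->
    {ae mu, forall x, sinkhorn_phi mu nu c s x = (F s x)%:E} ->
    measurable_fun setT (sinkhorn_psi mu nu c s) /\
    {ae nu, forall y, sinkhorn_psi mu nu c s y = (G s y)%:E}.
  move=> mphi phiE; split; first exact: measurable_sinkhorn_Y.
  rewrite /sinkhorn_psi (eq_sinkhorn_Y mc mphi _ phiE).
    by have [] := half_step_Y (admissibleP s).
  exact: measurable_int (L1_potential_X s).
elim: t => [|t [mphi phiE mpsi psiE]].
  have [||mpsi psiE] := half 0%N; first exact: measurable_cst.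
    by apply: aeW.
  by split => //; exact: aeW.
have sX : sinkhorn_phi mu nu c t.+1 =
    sinkhorn_Y nu transposed_cost (sinkhorn_psi mu nu c t) by [].
have mphi' : measurable_fun setT (sinkhorn_phi mu nu c t.+1).
  by rewrite sX; exact: measurable_sinkhorn_Y.
have phiE' : {ae mu, forall x, sinkhorn_phi mu nu c t.+1 x = (F t.+1 x)%:E}.
  rewrite sX (eq_sinkhorn_Y mcs mpsi _ psiE).
    by have [] := half_step_X (admissibleP t).
  exact: measurable_int (L1_potential_Y t).
by have [mpsi' psiE'] := half t.+1 mphi' phiE'; split.
Qed.

End sinkhorn_potentials.

(** * Densities and relative entropy *)

Section densities.
Context d (T : measurableType d) (R : realType).

(** Given a bound below, the negative part is integrable; a finite integral then
    forces the positive part to be integrable. *)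
Lemma integrable_of_lower_bound (P : {measure set T -> \bar R}) (f g : T -> R) :
  measurable_fun setT f -> L1 P g -> {ae P, forall x, g x <= f x} ->
  (\int[P]_x (f x)%:E < +oo)%E -> L1 P f.
Proof.
move=> mf Lg gf fy; have mfE : measurable_fun setT (EFin \o f) by exact/measurable_EFinP.
have negfin : (\int[P]_x (EFin \o f)^\- x < +oo)%E.
  have := integral_funeneg_lt_pinfty measurableT Lg; apply: le_lt_trans.
  apply: ae_le_integral.
  - exact: measurable_funeneg.
  - by apply: measurable_funeneg; exact: measurable_int Lg.
  - apply: filterS gf => x gfx.
    by rewrite !funenegE ge_max !le_max leeN2 lee_fin gfx lexx !orbT.
have neg0 : (0 <= \int[P]_x (EFin \o f)^\- x)%E by exact: integral_ge0.
have posfin : (\int[P]_x (EFin \o f)^\+ x < +oo)%E.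
  move: fy; rewrite integralE; move: neg0 negfin.
  set ip := (\int[P]_x _^\+ x)%E; set im := (\int[P]_x _^\- x)%E.
  by case: im => [a| |] //; case: ip => [b| |] // _ _ _; exact: ltry.
apply/integrableP; split => //.
rewrite -[X in (\int[P]_x X x)%E]/(abse \o (EFin \o f)) fune_abse ge0_integralD//.
- by rewrite lte_add_pinfty.
- exact: measurable_funepos.
- exact: measurable_funeneg.
Qed.

End densities.

Section density_probability.
Context d (T : measurableType d) (R : realType).
Variables (P : {measure set T -> \bar R}) (p : T -> R).
Hypotheses (mp : measurable_fun setT p) (p_ge0 : forall z, 0 <= p z).
Hypothesis p1 : (\int[P]_z (p z)%:E = 1)%E.

(** The proofs are arguments of the measure, so that its probability structure
    can be inferred from it. *)
Definition density_probability of measurable_fun setT p & (forall z, 0 <= p z)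
  & (\int[P]_z (p z)%:E = 1)%E := fun A : set T => (\int[P]_(z in A) (p z)%:E)%E.

Local Notation pi := (density_probability mp p_ge0 p1).

Let pi0 : pi set0 = 0%E. Proof. exact: integral_set0. Qed.

Let pi_ge0 A : (0 <= pi A)%E.
Proof. by apply: integral_ge0 => z _; rewrite lee_fin. Qed.

Let pi_sigma_additive : semi_sigma_additive pi.
Proof.
apply: semi_sigma_additive_nng_induced; first exact/measurable_EFinP.
by move=> z; rewrite lee_fin.
Qed.

HB.instance Definition _ := isMeasure.Build _ _ _ pi pi0 pi_ge0 pi_sigma_additive.

Let pi_setT : pi setT = 1%E. Proof. exact: p1. Qed.

HB.instance Definition _ := Measure_isProbability.Build _ _ _ pi pi_setT.

End density_probability.

Section relative_entropy_theory.
Context d (T : measurableType d) (R : realType) (m q : probability T R).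

(** Nonnegative representative of the Radon-Nikodym derivative; changing the
    derivative on a null set does not affect the relative entropy. *)
Lemma dominated_density : q `<< m -> exists r : T -> R,
  [/\ measurable_fun setT r, forall z, 0 <= r z,
    forall A, measurable A -> q A = (\int[m]_(z in A) (r z)%:E)%E,
    forall f : T -> \bar R, measurable_fun setT f -> (forall z, 0 <= f z)%E ->
      (\int[m]_z (f z * (r z)%:E) = \int[q]_z f z)%E &
    relative_entropy q m = (\int[q]_z lne (r z)%:E)%E].
Proof.
move=> qm; pose f := Radon_Nikodym_SigmaFinite.f q m.
have Lf : m.-integrable setT f := Radon_Nikodym_SigmaFinite.f_integrable qm.
have mf := measurable_int _ Lf.
have ffin z : f z \is a fin_num := Radon_Nikodym_SigmaFinite.f_fin_num qm z.
have fr z : (fine (f z))%:E = f z by rewrite fineK.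
exists (fun z => fine (f z)); split.
- exact: measurableT_comp.
- by move=> z; rewrite fine_ge0//; exact: Radon_Nikodym_SigmaFinite.f_ge0.
- move=> A mA; under eq_integral do rewrite fr.
  exact: Radon_Nikodym_SigmaFinite.f_integral.
- move=> g mg g0; under eq_integral do rewrite fr.
  exact: Radon_Nikodym_SigmaFinite.change_of_variables.
- rewrite /relative_entropy; case: pselect => // qm'.
  apply: ae_eq_integral => //.
  + exact: measurableT_comp measurable_lne _.
  + apply: (measurableT_comp measurable_lne).
    by apply/measurable_EFinP; exact: measurableT_comp.
  + have := ae_eq_Radon_Nikodym_SigmaFinite qm measurableT.
    move=> /(null_dominates_ae_eq measurableT qm).
    by apply: filterS => z /(_ I) + _; rewrite fr => <-.
Qed.

Variable r : T -> R.
Hypotheses (mr : measurable_fun setT r) (r_ge0 : forall z, 0 <= r z).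
Hypothesis qr : forall A, measurable A -> q A = (\int[m]_(z in A) (r z)%:E)%E.
Hypothesis qrE : forall f : T -> \bar R, measurable_fun setT f ->
  (forall z, 0 <= f z)%E -> (\int[m]_z (f z * (r z)%:E) = \int[q]_z f z)%E.

Lemma density_gt0 : {ae q, forall z, 0 < r z}.
Proof.
have mN : measurable (r @^-1` `]-oo, 0]%classic).
  by rewrite -[X in measurable X]setTI; apply: mr.
exists (r @^-1` `]-oo, 0]%classic); split => //.
  rewrite qr//; apply: integral0_eq => z /=; rewrite in_itv/= => rz.
  by congr EFin; apply/eqP; rewrite eq_le rz r_ge0.
by move=> z /= /negP; rewrite -leNgt in_itv.
Qed.

Section gibbs_inequality.
Variable w : T -> R.
Hypothesis Lw : L1 q w.
Hypothesis w1 : (\int[m]_z (expR (w z))%:E <= 1)%E.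

Let mw : measurable_fun setT w. Proof. exact: L1_measurable Lw. Qed.
(* [k] is expR (w z) / r z, set to 0 where [r] vanishes, and
   ln r >= w + 1 - k is the inequality 1 + u <= expR u at u = w - ln r. *)
Let k z := if r z <= 0 then 0 else expR (w z - ln (r z)).
Let low z := w z + 1 - k z.

Let mk : measurable_fun setT k.
Proof.
apply: measurable_fun_ifT => //; first exact: measurable_fun_ler.
by apply: measurableT_comp => //; apply: measurable_funB => //; exact: measurableT_comp.
Qed.

Let k_ge0 z : 0 <= k z. Proof. by rewrite /k; case: ifP => // _; exact: expR_ge0. Qed.

Let k1 : (\int[q]_z (k z)%:E <= 1)%E.
Proof.
rewrite -qrE; [|exact/measurable_EFinP|by move=> z; rewrite lee_fin].
apply: le_trans w1; apply: ge0_le_integral => //.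
- by move=> z _; rewrite -EFinM lee_fin mulr_ge0.
- by apply: emeasurable_funM; exact/measurable_EFinP.
- by apply/measurable_EFinP; exact: measurableT_comp.
- move=> z _; rewrite -EFinM lee_fin /k.
  case: (leP (r z) 0) => r0; first by rewrite mul0r expR_ge0.
  by rewrite expRD expRN lnK ?posrE// divfK// gt_eqF.
Qed.

Let Lk : L1 q k.
Proof. by apply: ge0_L1 => //; exact: le_lt_trans k1 (ltry _). Qed.

Let Llow : L1 q low.
Proof. by apply: L1B => //; apply: L1D => //; exact: L1_cst. Qed.

Let le_low_ln : {ae q, forall z, low z <= ln (r z)}.
Proof.
apply: filterS density_gt0 => z r0.
have -> : low z = w z + 1 - expR (w z - ln (r z)).
  by rewrite /low /k leNgt r0.
by have := expR_ge1Dx (w z - ln (r z)); lra.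
Qed.

Let int_low : \int[q]_z w z <= \int[q]_z low z.
Proof.
rewrite RintegralB//; last by apply: L1D => //; exact: L1_cst.
rewrite RintegralD//; last exact: L1_cst.
rewrite Rintegral_prob_cst.
have : \int[q]_z k z <= 1 by rewrite -lee_fin EFin_Rintegral.
lra.
Qed.

Let mlnr : measurable_fun setT (fun z => ln (r z)).
Proof. exact: measurableT_comp. Qed.

Let lne_ln : (\int[q]_z lne (r z)%:E = \int[q]_z (ln (r z))%:E)%E.
Proof.
apply: ae_eq_integral => //.
- by apply: (measurableT_comp measurable_lne); exact/measurable_EFinP.
- exact/measurable_EFinP.
- by apply: filterS density_gt0 => z r0 _; rewrite lne_EFin.
Qed.

(** Positivity of relative entropy: the mean of [k] is the [m]-mass of expR w on
    the set where r > 0, hence at most 1. *)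
Lemma gibbs_inequality : (\int[q]_z (w z)%:E <= \int[q]_z lne (r z)%:E)%E.
Proof.
rewrite lne_ln; apply: (@le_trans _ _ (\int[q]_z (low z)%:E)%E).
  by rewrite -!EFin_Rintegral// lee_fin.
apply: ae_le_integral; last exact: le_low_ln.
- exact: measurable_int Llow.
- exact/measurable_EFinP.
Qed.

(** Equality in 1 + u <= expR u holds only at u = 0, so equality of the integrals
    forces r = expR w almost everywhere for [q]. *)
Lemma gibbs_inequality_eq :
  (\int[q]_z lne (r z)%:E <= \int[q]_z (w z)%:E)%E ->
  forall A, measurable A -> (q A <= \int[m]_(z in A) (expR (w z))%:E)%E.
Proof.
rewrite lne_ln => lew.
have Lln : L1 q (fun z => ln (r z)).
  apply: (integrable_of_lower_bound mlnr Llow le_low_ln).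
  by apply: le_lt_trans lew _; exact: integrable_lty.
have LD : L1 q (fun z => ln (r z) - low z) by exact: L1B.
have D0 : (\int[q]_z `|(ln (r z) - low z)%:E| = 0)%E.
  rewrite -[LHS]/(\int[q]_z (`|ln (r z) - low z|)%:E)%E.
  apply/eqP; rewrite eq_le integral_ge0 ?andbT//.
  rewrite -EFin_Rintegral; last exact: L1_norm.
  rewrite (ae_eq_Rintegral (g := fun z => ln (r z) - low z)).
  - rewrite RintegralB// lee_fin subr_le0; apply: le_trans int_low.
    by rewrite -lee_fin !EFin_Rintegral.
  - by apply: (@L1_measurable _ _ _ q); exact: L1_norm.
  - exact: L1_measurable LD.
  - by apply: filterS le_low_ln => z lz; rewrite ger0_norm// subr_ge0.
have rw : {ae q, forall z, r z = expR (w z)}.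
  have /(ae_eq_integral_abs q measurableT)[/(_ D0) ae0 _] := measurable_int _ LD.
  apply: filterS2 density_gt0 ae0 => z r0 /(_ I) /= [].
  have -> : low z = w z + 1 - expR (w z - ln (r z)).
    by rewrite /low /k leNgt r0.
  have [/eqP|x0] := eqVneq (w z - ln (r z)) 0.
    by rewrite subr_eq0 => /eqP -> _; rewrite lnK.
  by have := expR_gt1Dx x0; lra.
move=> A mA.
pose E := [set z | r z = expR (w z)].
have mE : measurable E.
  rewrite (_ : E = (fun z => r z == expR (w z)) @^-1` [set true]).
    rewrite -[X in measurable X]setTI; apply: measurable_fun_eqr => //.
    exact: measurableT_comp.
  by apply/seteqP; split => z /= => [->|/eqP//]; rewrite eqxx.
have -> : q A = q (A `&` E).
  have [N [mN N0 sub]] := rw.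
  rewrite (measureDI q mA mE) (subset_measure0 _ mN _ N0) ?add0e//.
    exact: measurableD.
  by move=> z [_ nE]; exact: sub.
rewrite qr//; last exact: measurableI.
rewrite (eq_integral (fun z => (expR (w z))%:E)); last first.
  by move=> z; rewrite inE => -[_ /= ->].
apply: ge0_subset_integral => //; first exact: measurableI.
by apply/measurable_EFinP; apply: measurable_funTS; exact: measurableT_comp.
Qed.

End gibbs_inequality.
End relative_entropy_theory.

(** * Gibbs couplings are optimal *)

Section pushforward_integration.
Context d1 d2 (S : measurableType d1) (T : measurableType d2) (R : realType).
Variables (q : probability S R) (P : probability T R) (phi : S -> T).
Hypothesis mphi : measurable_fun setT phi.
Hypothesis qP : forall A, measurable A -> pushforward q phi A = P A.

Lemma L1_pushforward (f : T -> R) : L1 P f ->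
  L1 q (fun x => f (phi x)) /\ \int[q]_x f (phi x) = \int[P]_y f y.
Proof.
move=> Lf; have mf := measurable_int _ Lf.
have PE g : (\int[P]_y g y = \int[pushforward q phi]_y g y)%E.
  by apply: eq_measure_integral => A mA _; exact/esym/qP.
have Lq : L1 q (fun x => f (phi x)).
  apply/integrableP; split; first exact: (measurableT_comp mf mphi).
  have /integrableP[_] := Lf; apply: le_lt_trans.
  rewrite PE ge0_integral_pushforward//.
  exact: measurableT_comp.
split => //; congr fine.
by rewrite PE (integral_pushforward mphi).
Qed.

End pushforward_integration.

Section gibbs_couplings_are_optimal.
Context (R : realType) (d1 d2 : measure_display).
Context (X : measurableType d1) (Y : measurableType d2).
Variables (mu : probability X R) (nu : probability Y R) (c : X * Y -> R).
Local Notation m := (mu \x nu)%E.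
Variables (F : X -> R) (G : Y -> R) (pi : probability (X * Y)%type R).
Hypotheses (mc : measurable_fun setT c) (c_ge0 : forall z, 0 <= c z).
Hypotheses (LF : L1 mu F) (LG : L1 nu G).
Hypothesis pip : forall A, measurable A ->
  pi A = (\int[m]_(z in A) (gibbs_density c F G z)%:E)%E.
Hypothesis pi_coupling : coupling mu nu pi.

Local Notation p := (gibbs_density c F G).
Local Notation dual := (\int[mu]_x F x + \int[nu]_y G y).

Let w z := F z.1 + G z.2 - c z.

Let mw : measurable_fun setT w.
Proof.
apply: measurable_funB => //; apply: measurable_funD;
  apply: measurableT_comp => //;
  [exact: L1_measurable LF|exact: L1_measurable LG].
Qed.

Let mp : measurable_fun setT p.
Proof. exact: measurableT_comp. Qed.

Let p_ge0 z : 0 <= p z. Proof. exact: expR_ge0. Qed.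

Let p1 : (\int[m]_z (p z)%:E = 1)%E.
Proof. by rewrite -pip// probability_setT. Qed.

Lemma L1_coupling_potentials (q : probability (X * Y)%type R) :
  coupling mu nu q -> L1 q (fun z => F z.1 + G z.2) /\
  \int[q]_z (F z.1 + G z.2) = dual.
Proof.
move=> [qX qY].
have [L1F I1] := L1_pushforward measurable_fst qX LF.
have [L2G I2] := L1_pushforward measurable_snd qY LG.
by split; [exact: L1D|rewrite RintegralD// I1 I2].
Qed.

(** Gibbs' inequality for w = F + G - c, whose integral against a coupling of
    finite transport cost is the dual value minus that cost. If the transport
    cost is infinite, Gibbs' inequality for w = 0 keeps the entropy from being
    -oo. *)
Lemma dual_le_cost (q : probability (X * Y)%type R) : coupling mu nu q ->
  (dual%:E <= eot_cost mu nu c q)%E /\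
  ((eot_cost mu nu c q <= dual%:E)%E ->
   forall A, measurable A -> (q A <= pi A)%E).
Proof.
move=> cq; have [Lpot Ipot] := L1_coupling_potentials cq.
have cost0 : (0 <= \int[q]_z (c z)%:E)%E.
  by apply: integral_ge0 => z _; rewrite lee_fin.
have [qm|nqm] := pselect (q `<< (mu \x nu)%E); last first.
  have -> : eot_cost mu nu c q = +oo%E.
    rewrite /eot_cost /relative_entropy; case: pselect => // _.
    by rewrite addey// -ltNye; exact: lt_le_trans cost0.
  by split; rewrite ?leey// leye_eq.
have [r [mr r0 qr qrE entE]] := dominated_density qm.
rewrite /eot_cost entE.
have ent0 : (0 <= \int[q]_z lne (r z)%:E)%E.
  have := @gibbs_inequality _ _ _ m q r mr r0 qr qrE (cst 0) (L1_cst _ _).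
  rewrite integral0; apply; rewrite /cst expR0.
  by rewrite integral_prob1.
have [cy|cfin] := eqVneq (\int[q]_z (c z)%:E)%E +oo%E.
  rewrite cy addye; last by rewrite -ltNye; exact: lt_le_trans ent0.
  by split; rewrite ?leey// leye_eq.
have Lc : L1 q c by apply: ge0_L1 => //; rewrite ltey.
have Lw : L1 q w by exact: L1B.
have w1 : (\int[m]_z (expR (w z))%:E <= 1)%E by rewrite -p1.
have Iw : (\int[q]_z (w z)%:E = dual%:E - \int[q]_z (c z)%:E)%E.
  by rewrite -!EFin_Rintegral// -EFinB RintegralB// Ipot.
have cfin' : (\int[q]_z (c z)%:E)%E \is a fin_num by rewrite ge0_fin_numE// ltey.
split.
  by rewrite addeC -leeBlDr// -Iw; exact: (gibbs_inequality mr r0 qr qrE).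
move=> ledual A mA; rewrite pip//.
apply: (gibbs_inequality_eq mr r0 qr qrE Lw w1) => //.
by rewrite Iw leeBrDr// addeC.
Qed.

(** For the Gibbs coupling the logarithm of the density is F + G - c, so
    the cost telescopes to the dual value once [c] is known to be integrable;
    this follows from c <= F + G - 1 + exp (c - F - G), as the last term is the
    inverse of the density. *)
Lemma gibbs_cost_le_dual : (eot_cost mu nu c pi <= dual%:E)%E.
Proof.
have [Lpot Ipot] := L1_coupling_potentials pi_coupling.
have pim : pi `<< (mu \x nu)%E.
  apply/null_content_dominatesP => A mA mA0.
  rewrite pip//; apply: null_set_integral => //.
  by apply: measurable_funTS; exact/measurable_EFinP.
have [r [mr r0 qr qrE entE]] := dominated_density pim.
have rp : {ae m, forall z, r z = p z}.
  have : ae_eq m setT (EFin \o r) (EFin \o p).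
    apply: integral_ae_eq => //.
    - apply: ge0_L1 => //; rewrite -qr// probability_setT; exact: ltry.
    - exact/measurable_EFinP.
    - by move=> A _ mA; rewrite -qr// pip.
  by apply: filterS => z /(_ I) [].
have rp' : {ae pi, forall z, ln (r z) = w z}.
  have rpT : ae_eq (mu \x nu)%E setT r p by apply: filterS rp => z ->.
  have := null_dominates_ae_eq measurableT pim rpT.
  by apply: filterS => z /(_ I) ->; rewrite expRK.
have entw : (\int[pi]_z lne (r z)%:E = \int[pi]_z (w z)%:E)%E.
  apply: ae_eq_integral => //.
  - by apply: (measurableT_comp measurable_lne); exact/measurable_EFinP.
  - exact/measurable_EFinP.
  - apply: filterS2 rp' (density_gt0 mr r0 qr) => z rw rz _.
    by rewrite lne_EFin// rw.
have Linv : L1 pi (fun z => expR (- w z)).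
  apply: ge0_L1 => //; first by apply: measurableT_comp => //; exact: measurable_funN.
  rewrite -qrE; last 2 first.
  - apply/measurable_EFinP; apply: measurableT_comp => //.
    exact: measurable_funN.
  - by move=> z; rewrite lee_fin expR_ge0.
  rewrite (ae_eq_integral (cst 1%E))//=.
  - by rewrite integral_prob1 ltry.
  - apply: emeasurable_funM; apply/measurable_EFinP => //.
    by apply: measurableT_comp => //; exact: measurable_funN.
  - by apply: filterS rp => z -> _; rewrite -EFinM -expRD addrC subrr expR0.
have Lc : L1 pi c.
  apply: (@L1_le_ae _ _ _ _ _ (fun z => F z.1 + G z.2 - 1 + expR (- w z))) => //.
    by apply: L1D => //; apply: L1B => //; exact: L1_cst.
  apply: aeW => z; rewrite ger0_norm//.
  by have := expR_ge1Dx (- w z); rewrite /w; lra.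
rewrite /eot_cost entE entw -!EFin_Rintegral//; last exact: L1B.
by rewrite -EFinD RintegralB// Ipot lee_fin addrC subrK.
Qed.

(** A minimizer attains the dual value, hence is dominated setwise by the Gibbs
    coupling; two probabilities so ordered agree, as taking complements shows. *)
Lemma gibbs_coupling_optimal :
  (eot_value mu nu c < +oo)%E /\ optimal_coupling mu nu c pi.
Proof.
have valueE : eot_value mu nu c = dual%:E.
  apply/eqP; rewrite eq_le; apply/andP; split.
    apply: le_trans gibbs_cost_le_dual; apply: ereal_inf_lbound.
    by exists pi.
  by apply: le_ereal_inf_tmp => _ [q cq <-]; have [] := dual_le_cost cq.
split; first by rewrite valueE ltry.
split.
  split => //; apply/eqP; rewrite valueE eq_le gibbs_cost_le_dual /=.
  by have [] := dual_le_cost pi_coupling.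
move=> q [cq]; rewrite valueE => qdual A mA.
have qpi B : measurable B -> (q B <= pi B)%E.
  by apply: (dual_le_cost cq).2; rewrite qdual.
have := qpi _ (measurableC mA); have := qpi _ mA.
rewrite !probability_setC//.
have := fin_num_measure q A mA; have := fin_num_measure pi A mA.
case: (q A) => // a; case: (pi A) => // b _ _.
rewrite !lee_fin => ab ba; congr EFin; lra.
Qed.

End gibbs_couplings_are_optimal.

(** * Convergence of the iterates *)

Section entropy_controls_L1.
Context {R : realType}.

(** With expR u = v^2, the inequality 1 + u / 2 <= v gives
    (v - 1)^2 <= expR u - 1 - u, and |v^2 - 1| <= (v - 1)^2 + 2 |v - 1|. Integrated
    over u = F_t - F_{t+1}, this bounds an L1 distance by a relative entropy. *)
Lemma norm_expRB1_le (u eta : R) : 0 < eta ->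
  `|expR u - 1| <= eta + (1 + 1 / eta) * (expR u - 1 - u).
Proof.
move=> eta0; pose v := expR (u / 2).
have -> : expR u = v ^+ 2 by rewrite expr2 -expRD; congr expR; lra.
have v0 : 0 < v := expR_gt0 _.
have uv : u <= 2 * (v - 1) by have := expR_ge1Dx (u / 2); rewrite -/v; lra.
have D0 : (v - 1) ^+ 2 <= v ^+ 2 - 1 - u by nra.
apply: (@le_trans _ _ (eta + (1 + 1 / eta) * (v - 1) ^+ 2)); last first.
  rewrite lerD2l; apply: ler_wpM2l => //.
  by rewrite addr_ge0// divr_ge0// ltW.
have -> : v ^+ 2 - 1 = (v - 1) * ((v - 1) + 2) by ring.
rewrite normrM; have := ler_normD (v - 1) 2; rewrite (ger0_norm (ler0n _ 2)).
have sq : (v - 1) ^+ 2 = `|v - 1| ^+ 2 by rewrite real_normK ?num_real.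
rewrite sq; set x := `|v - 1|; have x0 : 0 <= x := normr_ge0 _ => le2.
apply: (@le_trans _ _ (x * (x + 2))); first exact: ler_wpM2l.
suff : 2 * x <= eta + x ^+ 2 / eta.
  have -> : (1 + 1 / eta) * x ^+ 2 = x ^+ 2 + x ^+ 2 / eta by field; rewrite gt_eqF.
  have -> : x * (x + 2) = x ^+ 2 + 2 * x by ring.
  lra.
have -> : eta + x ^+ 2 / eta = (eta ^+ 2 + x ^+ 2) / eta by field; rewrite gt_eqF.
by rewrite ler_pdivlMr//; have := sqr_ge0 (x - eta); nra.
Qed.

End entropy_controls_L1.

Section sinkhorn_convergence.
Context (R : realType) (d1 d2 : measure_display).
Context (X : measurableType d1) (Y : measurableType d2).
Variables (mu : probability X R) (nu : probability Y R) (c : X * Y -> R).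
Local Notation m := (mu \x nu)%E.
Hypotheses (c_ge0 : forall z, 0 <= c z) (Lc : L1 m c).

Local Notation F := (potential_X mu nu c).
Local Notation G := (potential_Y mu nu c).
Local Notation p t := (gibbs_density c (F t) (G t)).
Local Notation C1 := (cost_X nu c).
Local Notation C2 := (cost_Y mu c).

(** The density of the first marginal of the iterate pi_{2t}. *)
Definition fst_density t x := expR (F t x - F t.+1 x).
Local Notation h := fst_density.
Local Notation delta t := (\int[mu]_x `|h t x - 1|).

Let mc : measurable_fun setT c. Proof. exact: L1_measurable Lc. Qed.
Let LF t : L1 mu (F t). Proof. exact: L1_potential_X. Qed.
Let LG t : L1 nu (G t). Proof. exact: L1_potential_Y. Qed.
Let LC1 : L1 mu C1. Proof. exact: L1_cost_X. Qed.
Let LC2 : L1 nu C2. Proof. exact: L1_cost_Y. Qed.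

Let mh t : measurable_fun setT (h t).
Proof.
apply: measurableT_comp => //.
by apply: measurable_funB; [exact: L1_measurable (LF t)|exact: L1_measurable (LF t.+1)].
Qed.

Let h1 t : (\int[mu]_x (h t x)%:E <= 1)%E.
Proof. by have [] := half_step_X c_ge0 Lc (admissibleP c_ge0 Lc t). Qed.

Let Lh t : L1 mu (h t).
Proof.
apply: ge0_L1 => //; first by move=> x; exact: expR_ge0.
exact: le_lt_trans (h1 t) (ltry _).
Qed.

Let K := 2 * \int[mu]_x C1 x + 2 * \int[nu]_y C2 y.

Let FK t : \int[mu]_x `|F t x| <= K.
Proof.
have C20 : 0 <= \int[nu]_y C2 y by apply: Rintegral_ge0 => y _; exact: cost_Y_ge0.
have [_ F0 _] := admissibleP c_ge0 Lc t.
have := L1_norm_le (LF t) LC1 (cost_X_ge0 nu c_ge0) (potential_X_le_cost c_ge0 Lc t) F0.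
by rewrite /K; lra.
Qed.

Let GK t : \int[nu]_y `|G t y| <= K.
Proof.
have C10 : 0 <= \int[mu]_x C1 x by apply: Rintegral_ge0 => x _; exact: cost_X_ge0.
have [[_ G0 _] _ _] := half_step_Y c_ge0 Lc (admissibleP c_ge0 Lc t).
have := L1_norm_le (LG t) LC2 (cost_Y_ge0 mu c_ge0) (potential_Y_le_cost c_ge0 Lc t) G0.
by rewrite /K; lra.
Qed.

Lemma sinkhorn_fst_marginal t : {ae mu, forall x,
  (\int[nu]_y (p t (x, y))%:E = (h t x)%:E)%E}.
Proof.
have [_ mF _ _] := half_step_X c_ge0 Lc (admissibleP c_ge0 Lc t).
have mk : measurable_fun setT (fun z => expR (F t.+1 z.1 + G t z.2 - c z)).
  by apply: measurable_gibbs_density => //;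
    [exact: L1_measurable (LF t.+1)|exact: L1_measurable (LG t)].
apply: filterS mF => x mFx; rewrite -[RHS]mule1 -mFx.
rewrite -ge0_integralZl_EFin//; last 2 first.
- by apply/measurable_EFinP; exact: (measurable_section_snd x mk).
- exact: expR_ge0.
apply: eq_integral => y _; rewrite -EFinM -expRD; congr (expR _)%:E => /=; ring.
Qed.

Lemma sinkhorn_snd_marginal t : {ae nu, forall y,
  (\int[mu]_x (p t (x, y))%:E = 1)%E}.
Proof. by have [] := half_step_Y c_ge0 Lc (admissibleP c_ge0 Lc t). Qed.

(** The integrals of the potentials increase and are bounded by that of
    [cost_X]. *)
Lemma dual_gain_cvg0 :
  (fun t => \int[mu]_x F t.+1 x - \int[mu]_x F t x) @ \oo --> 0.
Proof.
pose a t := \int[mu]_x F t x.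
have /cvg_ex[l al] : cvgn a.
  apply: nondecreasing_is_cvgn.
    apply/nondecreasing_seqP => t.
    by have [[]] := half_step_X c_ge0 Lc (admissibleP c_ge0 Lc t).
  exists (\int[mu]_x C1 x) => _ [t _ <-].
  by apply: ae_le_Rintegral => //; exact: potential_X_le_cost.
rewrite -(subrr l); apply: cvgB => //.
by have := al; rewrite -(cvg_shiftS a).
Qed.

Lemma fst_marginal_cvg : (fun t => delta t) @ \oo --> 0.
Proof.
have deltaE t eta : 0 < eta -> delta t <=
    eta + (1 + 1 / eta) * (\int[mu]_x F t.+1 x - \int[mu]_x F t x).
  move=> eta0; have Ld : L1 mu (fun x => F t x - F t.+1 x) by exact: L1B.
  have Lh1 : L1 mu (fun x => h t x - 1) by apply: L1B => //; exact: L1_cst.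
  have Lr : L1 mu (fun x => h t x - 1 - (F t x - F t.+1 x)) by exact: L1B.
  apply: (@le_trans _ _ (\int[mu]_x
      (eta + (1 + 1 / eta) * (h t x - 1 - (F t x - F t.+1 x))))).
    apply: le_Rintegral => //.
    - exact: L1_norm.
    - by apply: L1D; [exact: L1_cst|exact: L1Z].
    - by move=> x _; exact: norm_expRB1_le.
  rewrite RintegralD//; [|exact: L1_cst|exact: L1Z].
  rewrite Rintegral_prob_cst RintegralZl// lerD2l ler_wpM2l//.
    by rewrite addr_ge0// divr_ge0// ltW.
  rewrite (RintegralB _ Lh1 Ld)//.
  have -> : \int[mu]_x (h t x - 1) = \int[mu]_x h t x - 1.
    by rewrite RintegralB//; [rewrite Rintegral_prob_cst|exact: Lh|exact: L1_cst].
  rewrite (RintegralB _ (LF t) (LF t.+1))//.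
  have : \int[mu]_x h t x <= 1 by rewrite -lee_fin EFin_Rintegral.
  lra.
apply/cvgrPdist_le => e e0.
pose eta := e / 2; have eta0 : 0 < eta by rewrite divr_gt0.
have L0 : 0 < 1 + 1 / eta by rewrite addr_gt0// divr_gt0.
have /cvgrPdist_le/(_ (eta / (1 + 1 / eta)) (divr_gt0 eta0 L0)) := dual_gain_cvg0.
apply: filterS => t; rewrite !sub0r !normrN => gain.
rewrite ger0_norm; last exact: Rintegral_ge0.
move: gain => /(le_trans (ler_norm _)); rewrite ler_pdivlMr// mulrC => small.
by apply: le_trans (deltaE t eta eta0) _; rewrite /eta in small *; lra.
Qed.

(* [uphalf n] and [n./2] are t and t for n = 2t, and t + 1 and t for n = 2t + 1. *)
Definition iterate_density (n : nat) : X * Y -> R :=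
  gibbs_density c (F (uphalf n)) (G n./2).

Lemma sinkhorn_iterateE n (A : set (X * Y)) : measurable A ->
  sinkhorn_iterate mu nu c n A = (\int[m]_(z in A) (iterate_density n z)%:E)%E.
Proof.
move=> mA.
have gen s t : potential_measure mu nu c (sinkhorn_phi mu nu c s) (sinkhorn_psi mu nu c t) A
    = (\int[m]_(z in A) (gibbs_density c (F s) (G t) z)%:E)%E.
  have [mphi phiE _ _] := sinkhorn_phi_psiE c_ge0 Lc s.
  have [_ _ mpsi psiE] := sinkhorn_phi_psiE c_ge0 Lc t.
  apply: ae_eq_integral => //.
  - apply: measurable_funTS; apply: (measurableT_comp measurable_expeR).
    apply: emeasurable_funB; last exact/measurable_EFinP.
    by apply: emeasurable_funD; exact: measurableT_comp.
  - apply/measurable_EFinP/measurable_funTS.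
    by apply: measurable_gibbs_density => //;
      [exact: L1_measurable (LF s)|exact: L1_measurable (LG t)].
  - by apply: filterS2 (ae_fst nu phiE) (ae_snd mu psiE) => z -> -> _.
rewrite /sinkhorn_iterate /iterate_density uphalf_half.
by case: (odd n); rewrite gen ?add1n ?add0n.
Qed.

(** An odd iterate multiplies the density of the preceding one by 1 / h_t, and
    int |1 / h_t - 1| h_t dmu = int |1 - h_t| dmu. *)
Lemma iterate_density_dist n : L1 m (iterate_density n) /\
  \int[m]_z `|iterate_density n z - p n./2 z| <= delta n./2.
Proof.
rewrite /iterate_density uphalf_half; set t := n./2.
have Lp : L1 m (p t).
  exact: (L1_gibbs mc LF LG Lh sinkhorn_fst_marginal).
case: (odd n); last first.
  rewrite add0n; split => //.
  under eq_Rintegral do rewrite subrr normr0.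
  by rewrite Rintegral_prob_cst; exact: Rintegral_ge0.
rewrite add1n.
pose phi x := expR (F t.+1 x - F t x).
have mphi : measurable_fun setT phi.
  apply: measurableT_comp => //.
  by apply: measurable_funB; [exact: L1_measurable (LF t.+1)|exact: L1_measurable (LF t)].
have densE z : gibbs_density c (F t.+1) (G t) z = phi z.1 * p t z.
  by rewrite /gibbs_density -expRD; congr expR; ring.
have phih x : phi x * h t x = 1 by rewrite -expRD -[RHS]expR0; congr expR; ring.
have mp : measurable_fun setT (p t) := L1_measurable Lp.
have Lphih : L1 mu (fun x => phi x * h t x).
  by under eq_fun do rewrite phih; exact: L1_cst.
have [Ldens _] := integral_fst_marginal mp (fun z => expR_ge0 _) mphi Lphih
  (sinkhorn_fst_marginal t).
split; first by under eq_fun do rewrite densE.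
have absE x : `|phi x - 1| * h t x = `|h t x - 1|.
  have h0 : 0 < h t x := expR_gt0 _.
  by rewrite -[X in _ * X](gtr0_norm h0) -normrM mulrBl phih mul1r distrC.
have mphi1 : measurable_fun setT (fun x => `|phi x - 1|).
  by apply: measurableT_comp => //; exact: measurable_funB.
have Lphih1 : L1 mu (fun x => `|phi x - 1| * h t x).
  under eq_fun do rewrite absE.
  by apply: L1_norm; apply: L1B => //; exact: L1_cst.
have [_ I] := integral_fst_marginal mp (fun z => expR_ge0 _) mphi1 Lphih1
  (sinkhorn_fst_marginal t).
have -> : \int[m]_z `|gibbs_density c (F t.+1) (G t) z - p t z| =
    \int[m]_z (`|phi z.1 - 1| * p t z).
  apply: eq_Rintegral => z _; rewrite densE.
  by rewrite -[X in _ = _ * X](gtr0_norm (expR_gt0 _)) -normrM mulrBl mul1r.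
by rewrite I; under eq_Rintegral do rewrite absE.
Qed.

Theorem sinkhorn_converges :
  (eot_value mu nu c < +oo)%E /\
  exists2 pistar : probability (X * Y)%type R,
    optimal_coupling mu nu c pistar &
    total_variation_dist (sinkhorn_iterate mu nu c n) pistar
      @[n --> \oo] --> 0%E.
Proof.
have delta_cvg0 := fst_marginal_cvg.
have [Fi [Gi [LFi LGi Lq pq]]] := gibbs_limit mc c_ge0
  (cost_X_ge0 nu c_ge0) (cost_Y_ge0 mu c_ge0) LC1 LC2 LF LG FK GK
  (potential_X_le_cost c_ge0 Lc) (potential_Y_le_cost c_ge0 Lc) Lh
  sinkhorn_fst_marginal sinkhorn_snd_marginal delta_cvg0.
set q := gibbs_density c Fi Gi in Lq pq.
have mq := L1_measurable Lq.
have q0 z : 0 <= q z := expR_ge0 _.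
have qX := limit_fst_marginal mc LF LG Lh sinkhorn_fst_marginal delta_cvg0 Lq pq.
have qY := limit_snd_marginal mc LF LG Lh sinkhorn_fst_marginal sinkhorn_snd_marginal Lq pq.
have setE (A : set (X * Y)) : measurable A ->
    (\int[m]_(z in A) (q z)%:E = (\int[m]_z (\1_A z * q z))%:E)%E.
  move=> mA; rewrite EFin_Rintegral; last first.
    apply: (L1_boundedM _ _ Lq) => // z; first by rewrite ger0_norm// indicE; case: (z \in A).
  rewrite [LHS]integral_mkcond; apply: eq_integral => z _.
  by rewrite epatch_indic /= muleC EFinM.
have q1 : (\int[m]_z (q z)%:E = 1)%E.
  rewrite setE//; congr EFin.
  have -> : \int[m]_z (\1_setT z * q z) = \int[m]_z (cst 1 z.1 * q z).
    by apply: eq_Rintegral => z _; rewrite indicT.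
  by rewrite qX ?Rintegral_prob_cst// => x; rewrite normr1.
pose pistar : probability (X * Y)%type R := density_probability mq q0 q1.
have pistarE A : measurable A -> pistar A = (\int[m]_(z in A) (q z)%:E)%E by [].
have indic_le1 d (T : measurableType d) (A : set T) (x : T) :
    `|(\1_A x : R)| <= 1.
  by rewrite indicE; case: (x \in A); rewrite ?normr1 ?normr0.
have int_indic d (T : measurableType d) (P : probability T R) (A : set T) :
    measurable A -> (\int[P]_x (\1_A x : R))%:E = P A.
  move=> mA; rewrite EFin_Rintegral; first by rewrite integral_indic// setIT.
  by apply: L1_bounded => //; exact: indic_le1.
have cpi : coupling mu nu pistar.
  split => [A mA|B mB].
  - have mA' : measurable (@fst X Y @^-1` A).
      by rewrite -[X in measurable X]setTI; exact: measurable_fst.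
    rewrite /pushforward pistarE// setE// -int_indic//; congr EFin.
    by rewrite -qX.
  - have mB' : measurable (@snd X Y @^-1` B).
      by rewrite -[X in measurable X]setTI; exact: measurable_snd.
    rewrite /pushforward pistarE// setE// -int_indic//; congr EFin.
    by rewrite -qY.
have [fin opt] := gibbs_coupling_optimal mc c_ge0 LFi LGi pistarE cpi.
split => //; exists pistar => //.
have Ldist n : L1 m (fun z => iterate_density n z - q z).
  by apply: L1B => //; have [] := iterate_density_dist n.
have tv_le n : (total_variation_dist (sinkhorn_iterate mu nu c n) pistar <=
    (\int[m]_z `|iterate_density n z - q z|)%:E)%E.
  apply: ge_ereal_sup => _ [A mA <-].
  have [Ln _] := iterate_density_dist n.
  rewrite sinkhorn_iterateE// pistarE//.
  have LnA := integrableS measurableT mA (@subsetT _ A) Ln.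
  have LqA := integrableS measurableT mA (@subsetT _ A) Lq.
  rewrite -integralB//.
  have LdA := integrableS measurableT mA (@subsetT _ A) (Ldist n).
  apply: le_trans (le_abse_integral _ mA (measurable_int _ LdA)) _.
  rewrite EFin_Rintegral; last exact: L1_norm.
  apply: ge0_subset_integral => //.
  by apply: measurableT_comp => //; exact: measurable_int (Ldist n).
have tv_ge0 n :
    (0 <= total_variation_dist (sinkhorn_iterate mu nu c n) pistar)%E.
  by apply: le_trans (abse_ge0 _) (ereal_sup_ubound _); exists setT.
apply: (@squeeze_cvge _ _ _ _ (cst 0%E) _
    (fun n => (\int[m]_z `|iterate_density n z - q z|)%:E)).
- by apply: nearW => n; rewrite tv_ge0 tv_le.
- exact: cvg_cst.
apply: cvg_EFin; first exact: nearW.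
apply/cvgrPdist_le => e e0.
have e20 : 0 < e / 2 by rewrite divr_gt0.
have [N1 pqe] := pq _ e20.
have /cvgrPdist_le/(_ _ e20)[N2 _ de] := delta_cvg0.
exists (maxn N1 N2).*2 => // n /= Nn.
have N1n : (N1 <= n./2)%N.
  by rewrite geq_half_double (leq_trans _ Nn)// leq_double leq_maxl.
have N2n : (N2 <= n./2)%N.
  by rewrite geq_half_double (leq_trans _ Nn)// leq_double leq_maxr.
rewrite sub0r normrN ger0_norm; last exact: Rintegral_ge0.
have := de _ N2n; rewrite sub0r normrN ger0_norm; last exact: Rintegral_ge0.
have [Ln dn] := iterate_density_dist n => dle; have := pqe _ N1n => qle.
have Lp : L1 m (p n./2) := L1_gibbs mc LF LG Lh sinkhorn_fst_marginal _.
have tri : \int[m]_z `|iterate_density n z - q z| <=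
    \int[m]_z `|iterate_density n z - p n./2 z| + \int[m]_z `|q z - p n./2 z|.
  rewrite -RintegralD//; [|by apply: L1_norm; exact: L1B|by apply: L1_norm; exact: L1B].
  apply: le_Rintegral => //.
  - exact: L1_norm.
  - by apply: L1D; apply: L1_norm; exact: L1B.
  - by move=> z _; rewrite (distrC (q z)) ler_distD.
apply: le_trans tri _; rewrite [leRHS]splitr.
by apply: lerD qle; exact: le_trans dn dle.
Qed.

End sinkhorn_convergence.

Local Open Scope ereal_scope.

Theorem corollary3p2 (R : realType) (X Y : ptopologicalType)
    (polishX : polish R X) (polishY : polish R Y)
    (mu : probability (borel X) R) (nu : probability (borel Y) R)
    (c : X * Y -> R) (c_ge0 : forall z, (0 <= c z)%R)
    (c_continuous : continuous c)
    (c_expL1 : exists2 beta : R, (0 < beta)%R &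
       (mu \x nu).-integrable setT (fun z => (expR (beta * c z))%:E)) :
  eot_value mu nu c < +oo /\
  exists2 pistar : probability (borel X * borel Y)%type R,
    optimal_coupling mu nu c pistar &
    total_variation_dist (sinkhorn_iterate mu nu c n) pistar
      @[n --> \oo] --> 0.
Proof.
have [beta beta0 Lexp] := c_expL1.
have mexp := L1_measurable Lexp.
have cE z : c z = (beta^-1 * ln (expR (beta * c z)))%R.
  by rewrite expRK mulKf// gt_eqF.
have mc : measurable_fun [set: borel X * borel Y] c.
  rewrite (_ : c = fun z => beta^-1 * ln (expR (beta * c z)))%R; last exact/funext.
  by apply: measurable_funM => //; exact: measurableT_comp.
apply: sinkhorn_converges => //.
have Lexp' := L1Z beta^-1 Lexp.
apply: (L1_le_ae mc Lexp').
(* The bound is t <= exp t at t = beta * c z. *)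
apply: aeW => z; rewrite ger0_norm// -ler_pdivrMl ?invr_gt0// invrK.
by apply: le_trans (expR_ge1Dx _); rewrite lerDr.
Qed.
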